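(* (Liaison Addition for Arrangements.) Let $n\ge 2$ and let $\mathcal A_{fg}=\mathcal A_f\cup\mathcal A_g\subset\mathbb P^n$ be a hypersurface arrangement, where $f=f_1\cdots f_s$ and $g=g_1\cdots g_t$, such that: (i) any two distinct hypersurfaces in $\mathcal A_{fg}$ meet in a codimension two smooth subscheme (hence a smooth complete intersection); (ii) $\operatorname{codim}(f_i,f_j,g)=3$ whenever $i\ne j$; (iii) $\operatorname{codim}(f,g_i,g_j)=3$ whenever $i\neq j$. Then: (a) $$\mathrm{Jac}(fg)^{top}=\mathrm{Jac}(f)^{top}\cap\mathrm{Jac}(g)^{top}\cap\Big[\bigcap_{i,j}(f_i,g_j)\Big],$$ where $\bigcap_{i,j}(f_i,g_j)=(f,g)$; (b) $\mathrm{Jac}(fg)^{top}=g\cdot\mathrm{Jac}(f)^{top}+f\cdot\mathrm{Jac}(g)^{top}$; in particular, $\mathrm{Jac}(fg)^{top}$ is obtained by Liaison Addition from $\mathrm{Jac}(f)^{top}$ and $\mathrm{Jac}(g)^{top}$; (c) statements (a) and (b) continue to hold if $\mathrm{Jac}(fg)^{top}$, $\mathrm{Jac}(f)^{top}$ and $\mathrm{Jac}(g)^{top}$ are replaced by their radicals.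
   Context: $K$ is an algebraically closed field of characteristic zero and $S=K[x_0,\dots,x_n]$. $\mathcal A_f$ (resp. $\mathcal A_g$, $\mathcal A_{fg}$) is the arrangement of the hypersurfaces defined by the forms $f_1,\dots,f_s$ (resp. $g_1,\dots,g_t$, resp. all of $f_1,\dots,f_s,g_1,\dots,g_t$); the $f_i,g_j\in S$ are homogeneous of positive degree and define $s+t$ distinct hypersurfaces. For a form $h$, $\mathrm{Jac}(h)=\left(\frac{\partial h}{\partial x_0},\dots,\frac{\partial h}{\partial x_n}\right)$, and $\mathrm{Jac}(h)^{top}$ is the intersection of the primary components of height two in a primary decomposition of $\mathrm{Jac}(h)$ (equal to $S$ if there are none). $\operatorname{codim}(\cdot)$ is the codimension (height) of the ideal in $S$. It is not assumed that $\operatorname{codim}(f_i,f_j,f_k)=3$ or $\operatorname{codim}(g_i,g_j,g_k)=3$ for distinct $i,j,k$. Liaison Addition: given saturated ideals $I_{V_1},I_{V_2}$ of equidimensional locally Cohen-Macaulay codimension two (or empty) subschemes and a regular sequence $(F_1,F_2)$ of forms with $F_1\in I_{V_1}$, $F_2\in I_{V_2}$, one forms the ideal $F_2I_{V_1}+F_1I_{V_2}$.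
   Formalization: In ''obtained by Liaison Addition'' the two subschemes are required to be saturated and equidimensional of codimension two without embedded components (or empty), not locally Cohen-Macaulay, which can fail for n ≥ 4 (it is automatic for n = 2, 3). *)

(* Defs.v *)
From HB Require Import structures.
From mathcomp Require Import all_boot all_order all_algebra.
From mathcomp Require Import classical_sets.
From mathcomp Require Import mpoly.

Set Implicit Arguments.
Unset Strict Implicit.
Unset Printing Implicit Defensive.

Import GRing.Theory.

Local Open Scope classical_set_scope.
Local Open Scope ring_scope.

(* Ideals are classical sets: the structures of ring_quotient are restricted  *)
(* to proper decidable ideals, whereas the unit ideal setT is needed here.    *)

Section Ideals.
Variable R : comNzRingType.
Implicit Types (I J P Q : set R) (s : seq R).

Definition is_ideal I : Prop :=
  [/\ I 0, forall x y, I x -> I y -> I (x + y) & forall a x, I x -> I (a * x)].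

Definition ideal_gen s : set R :=
  [set p | exists c : nat -> R, p = \sum_(i < size s) c i * s`_i].

Definition radical I : set R := [set p | exists k : nat, I (p ^+ k)].

Definition is_prime P : Prop :=
  [/\ is_ideal P, ~ P 1 & forall x y, P (x * y) -> P x \/ P y].

Definition is_primary Q : Prop :=
  [/\ is_ideal Q, ~ Q 1 & forall x y, Q (x * y) -> Q x \/ radical Q y].

Definition prime_chain (C : nat -> set R) (h : nat) P : Prop :=
  [/\ forall i, (i <= h)%N -> is_prime (C i),
      forall i, (i < h)%N -> C i `<` C i.+1
    & C h = P].

Definition height_ge I (h : nat) : Prop :=
  forall P, is_prime P -> I `<=` P -> exists C, prime_chain C h P.

(* The least height of a prime containing I is exactly h. The unit ideal has  *)
(* infinite height, so that codim_eq setT h never holds.                      *)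
Definition codim_eq I (h : nat) : Prop := height_ge I h /\ ~ height_ge I h.+1.

(* Irredundant decomposition with pairwise distinct radicals; k = 0 is the    *)
(* decomposition of the unit ideal.                                           *)
Definition primary_decomposition I (k : nat) (Q : 'I_k -> set R) : Prop :=
  [/\ forall i, is_primary (Q i),
      I = \bigcap_(i in [set: 'I_k]) Q i,
      forall i j, i != j -> radical (Q i) <> radical (Q j)
    & forall i, ~ (\bigcap_(j in [set j : 'I_k | j != i]) Q j `<=` Q i)].

(* T is an I^top. This is a relation because height two components that are   *)
(* embedded depend on the decomposition; T is determined by I as soon as I    *)
(* has height at least two. With no component of height two, T = setT.        *)
Definition is_top I (T : set R) : Prop :=
  exists (k : nat) (Q : 'I_k -> set R),
    primary_decomposition I Q /\
    T = \bigcap_(i in [set i | codim_eq (Q i) 2]) Q i.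

Definition associated_prime I P : Prop :=
  is_prime P /\ exists x, P = [set a | I (a * x)].

Definition unmixed I (h : nat) : Prop :=
  forall P, associated_prime I P -> codim_eq P h.

Definition regular_sequence s : Prop :=
  (forall i x, (i < size s)%N ->
     ideal_gen (take i s) (s`_i * x) -> ideal_gen (take i s) x) /\
  ~ ideal_gen s 1.

(* The ideal a I + b J. *)
Definition scaled_sum (a : R) I (b : R) J : set R :=
  [set p | exists x y, [/\ I x, J y & p = a * x + b * y]].

End Ideals.

Section Forms.
Variables (K : fieldType) (m : nat).
Implicit Types (I J : set {mpoly K[m]}) (F : {mpoly K[m]}).

Definition hypersurface_form F : Prop :=
  F != 0 /\ exists d : nat, (0 < d)%N /\ F \is d.-homog.

Definition jacobian_ideal F : set {mpoly K[m]} :=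
  ideal_gen [seq F^`M(i) | i <- enum 'I_m].

Definition homogeneous_ideal I : Prop :=
  is_ideal I /\ forall F (d : nat), I F -> I (pihomog mdeg d F).

Definition saturated I : Prop :=
  forall F, (exists k : nat, forall e : 'X_{1..m}, mdeg e = k -> I ('X_[e] * F)) ->
  I F.

Definition jacobian_mx (s : seq {mpoly K[m]}) (v : 'I_m -> K) :
    'M[K]_(size s, m) :=
  \matrix_(i, j) (s`_i)^`M(j).@[v].

(* The projective scheme cut out by c = size s forms has codimension c and,   *)
(* at each of its closed points [v], the c gradients are independent. It is   *)
(* meant for K algebraically closed; by Euler's relation, the homogeneous     *)
(* Jacobian matrix has at [v] the rank of that of an affine chart.            *)
Definition smooth_intersection (s : seq {mpoly K[m]}) : Prop :=
  codim_eq (ideal_gen s) (size s) /\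
  forall v : 'I_m -> K,
    (exists i, v i != 0) -> (forall F, F \in s -> F.@[v] = 0) ->
    \rank (jacobian_mx s v) = size s.

(* Saturated ideal of a subscheme that is empty (I = setT, which has no       *)
(* associated prime) or equidimensional of codimension two without embedded   *)
(* components. In P^2 and P^3 such a subscheme is locally Cohen-Macaulay.     *)
Definition codim2_scheme_ideal I : Prop :=
  [/\ homogeneous_ideal I, saturated I & unmixed I 2].

(* Liaison addition in P^(m-1). Local Cohen-Macaulayness, often required of   *)
(* the two subschemes, plays no role in the construction and is not imposed:  *)
(* from P^4 on it may fail for the top dimensional part of a Jacobian scheme. *)
(* For instance, take the equation in K[x_0,..,x_3] of a plane arrangement in *)
(* P^3 whose Jac^top is not Cohen-Macaulay, and view it in K[x_0,..,x_4].     *)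
Definition liaison_addition I1 I2 F1 F2 J : Prop :=
  [/\ codim2_scheme_ideal I1 /\ codim2_scheme_ideal I2,
      (exists d : nat, F1 \is d.-homog) /\ (exists d : nat, F2 \is d.-homog),
      I1 F1 /\ I2 F2,
      regular_sequence [:: F1; F2]
    & J = scaled_sum F2 I1 F1 I2].

Definition join_family (s t : nat) (fs : 'I_s -> {mpoly K[m]})
    (gs : 'I_t -> {mpoly K[m]}) (k : 'I_s + 'I_t) : {mpoly K[m]} :=
  match k with inl i => fs i | inr j => gs j end.

End Forms.

(* Main.v *)
(* The top dimensional part of an ideal I of height at least two is the set   *)
(* of all x such that (I : x) has height at least three, and its radical is   *)
(* the intersection of the primes of height two containing I. All ideals can  *)
(* thus be compared in the local rings R_P, with P of height two. If f and g  *)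
(* lie in P, then P contains a single f_i and a single g_j, and by smoothness *)
(* some minor M of the Jacobian matrix of (f, g) is not in P. Since M lies in *)
(* Jac(f) and Jac(g), while f M and g M lie in Jac(fg), at P the ideals       *)
(* Jac(f) and Jac(g) are trivial and Jac(fg) = (f, g). If g is not in P, then *)
(* Jac(fg) = Jac(f) at P, because g^2 Jac(f) lies in Jac(fg), and similarly   *)
(* if f is not in P. Together with the unmixedness of (f, g), this yields     *)
(* (a). It also shows that g is regular modulo Jac(f)^top and f modulo        *)
(* Jac(g)^top, so that x = u f + v g in the intersection of (a) has v in      *)
(* Jac(f)^top and u in Jac(g)^top, which is (b).                              *)
(*                                                                            *)
(* Unmixedness holds because, after a linear change of coordinates, R/(a, b)  *)
(* is torsion free over K[x_0, .., x_(n-2)], while a prime P that meets this  *)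
(* ring only in 0 has height at most two. *)
Require Import Defs.
From HB Require Import structures.
From mathcomp Require Import all_boot all_order all_algebra.
From mathcomp Require Import boolp classical_sets.
From mathcomp Require Import mpoly.
From mathcomp Require Import ring zify.

Set Implicit Arguments.
Unset Strict Implicit.
Unset Printing Implicit Defensive.

Import GRing.Theory.

Local Open Scope classical_set_scope.
Local Open Scope ring_scope.

(** * Ideals and chains of primes *)

(** Top dimensional parts are determined at the primes of height at most two. By [is_topP], x lies
    in I^top exactly when each such prime P admits some u outside P with u x in I; by
    [radical_topP], the radical of I^top is the intersection of the primes of height at most two
    containing I. Both require height at least two, which [arrangement_jacobian_height] supplies for
    the three Jacobian ideals by reduction to a single form ([jacobian_height]).

    A prime of height at most two containing f and g contains one f_i and one g_j only
    ([unique_components]). Smoothness of this pair makes f and g transversal there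
    ([products_transversal]), and (f, g) generates the maximal ideal of the local ring
    ([products_local]). Identities between the derivatives of f, g and f g then give (a)
    ([top_product], [radical_top_product]), the inclusion in (f, g) resting on [products_unmixed].
    By transversality, g is regular modulo Jac(f)^top and f modulo Jac(g)^top, which turns (a) into
    (b) ([top_scaled_sum], [radical_top_scaled_sum]).

    The algebra behind this is of three kinds. Dimension theory is reduced to [height_elimination]:
    an ideal of height at least h meets a polynomial subring in r + 1 - h of the r variables.
    Together with division by monic polynomials ([monic_coordinates]), it yields
    [principal_unmixed], [two_unmixed] and generators of the local rings ([principal_local],
    [two_local]). The Nullstellensatz carries smoothness from closed points to primes
    ([smooth_minor]). Finally, the scaling action shows that top dimensional parts are homogeneous
    ([top_scheme]), as liaison addition requires. *)

Section IdealTheory.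
Variable R : comNzRingType.
Implicit Types (I J P Q : set R) (s : seq R) (a b x y : R).

Lemma ideal_zero I : is_ideal I -> I 0. Proof. by case. Qed.

Lemma ideal_add I x y : is_ideal I -> I x -> I y -> I (x + y).
Proof. by case=> _ + _; exact. Qed.

Lemma ideal_mull I a x : is_ideal I -> I x -> I (a * x).
Proof. by case=> _ _; exact. Qed.

Lemma ideal_mulr I a x : is_ideal I -> I x -> I (x * a).
Proof. by rewrite mulrC; exact: ideal_mull. Qed.

Lemma ideal_opp I x : is_ideal I -> I x -> I (- x).
Proof. by move=> hI Ix; rewrite -mulN1r; exact: ideal_mull. Qed.

Lemma ideal_sub I x y : is_ideal I -> I x -> I y -> I (x - y).
Proof. by move=> hI Ix Iy; apply: ideal_add => //; exact: ideal_opp. Qed.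

Lemma ideal_sum I (T : Type) (r : seq T) (p : pred T) (F : T -> R) :
  is_ideal I -> (forall i, p i -> I (F i)) -> I (\sum_(i <- r | p i) F i).
Proof.
move=> hI IF; apply: (big_ind I) => //; first exact: ideal_zero.
by move=> x y; exact: ideal_add.
Qed.

Lemma prime_ideal P : is_prime P -> is_ideal P. Proof. by case. Qed.

Lemma prime_neq1 P : is_prime P -> ~ P 1. Proof. by case. Qed.

Lemma primeM P x y : is_prime P -> P (x * y) -> P x \/ P y.
Proof. by case=> _ _; exact. Qed.

Lemma primeMN P x y : is_prime P -> ~ P x -> ~ P y -> ~ P (x * y).
Proof. by move=> Pp Px Py /(primeM Pp)[]. Qed.

Lemma primeX P x k : is_prime P -> P (x ^+ k) -> P x.
Proof.
move=> Pp; elim: k => [|k IHk]; first by rewrite expr0 => /(prime_neq1 Pp).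
by rewrite exprS => /(primeM Pp)[].
Qed.

Lemma primeXN P x k : is_prime P -> ~ P x -> ~ P (x ^+ k).
Proof. by move=> Pp Px /(primeX Pp). Qed.

Lemma prime_prodN P (T : Type) (r : seq T) (p : pred T) (F : T -> R) :
  is_prime P -> (forall i, p i -> ~ P (F i)) -> ~ P (\prod_(i <- r | p i) F i).
Proof.
move=> Pp PF; apply: (big_ind (fun x => ~ P x)) => //; first exact: prime_neq1.
by move=> x y; exact: primeMN.
Qed.

Lemma prime_prod P (T : finType) (F : T -> R) :
  is_prime P -> P (\prod_i F i) -> exists i, P (F i).
Proof.
move=> Pp; apply: contraPP => noF; apply: prime_prodN => // i _ PFi.
by apply: noF; exists i.
Qed.

Lemma ideal_gen_ideal s : is_ideal (ideal_gen s).
Proof.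
split=> [|x y [c ->] [d ->]|a x [c ->]].
- by exists (fun=> 0); rewrite big1 // => i _; rewrite mul0r.
- by exists (fun i => c i + d i); rewrite -big_split /=; apply: eq_bigr => i _;
    rewrite mulrDl.
- by exists (fun i => a * c i); rewrite mulr_sumr; apply: eq_bigr => i _;
    rewrite mulrA.
Qed.

Lemma ideal_gen_mem s x : x \in s -> ideal_gen s x.
Proof.
move=> /(nthP 0)[i lis <-]; exists (fun j => (j == i)%:R).
rewrite (bigD1 (Ordinal lis)) //= eqxx mul1r big1 ?addr0 // => j.
by rewrite -val_eqE /= => /negbTE ->; rewrite mul0r.
Qed.

Lemma ideal_gen_sub I s : is_ideal I -> (forall x, x \in s -> I x) ->
  ideal_gen s `<=` I.
Proof.
move=> hI Is x [c ->]; apply: ideal_sum => // i _; apply: ideal_mull => //.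
by apply: Is; exact: mem_nth.
Qed.

Lemma ideal_gen1P a x : ideal_gen [:: a] x <-> exists u, x = u * a.
Proof.
split=> [[c ->]|[u ->]]; last by exists (fun=> u); rewrite big_ord1.
by rewrite big_ord1 /=; exists (c 0%N).
Qed.

Lemma ideal_gen2P a b x :
  ideal_gen [:: a; b] x <-> exists u v, x = u * a + v * b.
Proof.
split=> [[c ->]|[u [v ->]]].
  by rewrite big_ord_recl big_ord1 /=; exists (c 0%N), (c 1%N).
by exists (fun i => if i is 0%N then u else v); rewrite big_ord_recl big_ord1.
Qed.

Lemma ideal_gen_consP a s x : ideal_gen (a :: s) x <->
  exists u, exists2 y, ideal_gen s y & x = u * a + y.
Proof.
split=> [[c ->]|[u [y [c ->] ->]]].
  rewrite big_ord_recl /=; exists (c 0%N).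
  by exists (\sum_(i < size s) c i.+1 * s`_i) => //; exists (fun i => c i.+1).
by exists (fun i => if i is j.+1 then c j else u); rewrite big_ord_recl.
Qed.

Lemma radical_ideal I : is_ideal I -> is_ideal (radical I).
Proof.
move=> hI; split=> [|x y [k Ix] [l Iy]|a x [k Ix]].
- by exists 1%N; rewrite expr1; exact: ideal_zero.
- exists (k + l)%N; rewrite exprDn; apply: ideal_sum => // i _.
  rewrite -mulr_natr; apply: ideal_mulr => //.
  have [li|li] := leqP l i.
    by rewrite -(subnKC li) exprD mulrCA; apply: ideal_mulr.
  have -> : (k + l - i = k + (l - i))%N by rewrite addnBA // ltnW.
  by rewrite exprD -mulrA; apply: ideal_mulr.
- by exists k; rewrite exprMn; exact: ideal_mull.
Qed.

Lemma radical_sub I : I `<=` radical I.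
Proof. by move=> x Ix; exists 1%N; rewrite expr1. Qed.

Lemma primary_ideal Q : is_primary Q -> is_ideal Q. Proof. by case. Qed.

Lemma radical_prime Q : is_primary Q -> is_prime (radical Q).
Proof.
case=> hQ Q1 Qpr; split; first exact: radical_ideal.
  by case=> k; rewrite expr1n.
move=> x y [k]; rewrite exprMn => /Qpr[Qx|[l Qy]]; first by left; exists k.
by right; exists (k * l)%N; rewrite exprM.
Qed.

Lemma radical_prime_sub I P : is_prime P -> I `<=` P -> radical I `<=` P.
Proof. by move=> Pp IP x [k /IP]; exact: primeX. Qed.

(* An ideal maximal among those disjoint from E is prime. *)
Lemma prime_avoiding I (E : set R) :
  is_ideal I -> E 1 -> (forall x y, E x -> E y -> E (x * y)) ->
  (forall x, I x -> ~ E x) ->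
  exists P, [/\ is_prime P, I `<=` P & forall x, P x -> ~ E x].
Proof.
move=> hI E1 EM IE.
pose good (J : set R) := [/\ is_ideal J, I `<=` J & forall x, J x -> ~ E x].
(* The alternative [J = set0] accounts for the empty chain, whose union is not an ideal. *)
have [|A [] PA Amax] := @Zorn_bigcup R [set J | J = set0 \/ good J].
  move=> F Fgood Ftot.
  have [[X [FX X0]]|F0] := pselect (exists X, F X /\ X !=set0); last first.
    left; apply/seteqP; split=> // x [X FX Xx].
    by case: F0; exists X; split=> //; exists x.
  have Fne Y y : F Y -> Y y -> good Y.
    by move=> FY Yy; case: (Fgood _ FY) => // Y0; rewrite Y0 in Yy.
  case: X0 => x0 Xx0; have [hX IX _] := Fne _ _ FX Xx0.
  right; split.
  - split; first by exists X => //; exact: ideal_zero.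
      move=> x y [Y FY Yx] [Z FZ Zy].
      have [hY _ _] := Fne _ _ FY Yx; have [hZ _ _] := Fne _ _ FZ Zy.
      have [YZ|ZY] := Ftot _ _ FY FZ.
        by exists Z => //; apply: ideal_add => //; exact: YZ.
      by exists Y => //; apply: ideal_add => //; exact: ZY.
    move=> a x [Y FY Yx]; exists Y => //; apply: ideal_mull => //.
    by have [] := Fne _ _ FY Yx.
  - by move=> x Ix; exists X => //; exact: IX.
  - by move=> x [Y FY Yx]; have [_ _] := Fne _ _ FY Yx; exact.
have good_I : good I by split.
case: PA => [A0|[hA IA AE]].
  case: (Amax I); last by right.
  by rewrite A0; split=> // /(_ 0 (ideal_zero hI)).
exists A; split=> //; split=> // [/AE|]; first by apply.
(* By maximality A + (z) meets [E]. Applied to x and y with x y in A, this yields an element of both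
   A and [E]. *)
have grow z : ~ A z -> exists a r, A a /\ E (a + r * z).
  move=> Az; pose B := [set w | exists a r, A a /\ w = a + r * z].
  have AB : A `<=` B by move=> a Aa; exists a, 0; rewrite mul0r addr0.
  apply: contrapT => noE; apply: (Amax B).
    by split=> // BA; apply: Az; apply: BA; exists 0, 1; split;
      [exact: ideal_zero|rewrite add0r mul1r].
  right; split; last 1 first.
  - by move=> w [a [r [Aa ->]]] Ew; apply: noE; exists a, r.
  - split; first by apply: AB; exact: ideal_zero.
      move=> _ _ [a [r [Aa ->]]] [a' [r' [Aa' ->]]].
      exists (a + a'), (r + r'); split; first exact: ideal_add.
      by rewrite mulrDl addrACA.
    move=> c _ [a [r [Aa ->]]]; exists (c * a), (c * r).
    by split; [exact: ideal_mull|rewrite mulrDr mulrA].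
  - exact: subset_trans AB.
move=> x y Axy; apply: contrapT => /not_orP[/grow[a [r [Aa Ex]]]].
move=> /grow[b [q [Ab Ey]]].
apply: (AE _ _ (EM _ _ Ex Ey)).
rewrite mulrDl; apply: ideal_add => //; first exact: ideal_mulr.
rewrite mulrDr; apply: ideal_add => //; first exact: ideal_mull.
have -> : r * x * (q * y) = r * q * (x * y) by ring.
exact: ideal_mull.
Qed.

(** For a prime P, this says that the height is at least h; [~ has_chain P 3] thus reads: P has
    height at most two. *)
Definition has_chain P h := exists C, prime_chain C h P.

Lemma has_chainW P h : has_chain P h.+1 -> has_chain P h.
Proof.
case=> C [Cp Clt Ch]; exists (fun i => C i.+1).
by split=> // i lih; [exact: Cp|exact: Clt].
Qed.

Lemma has_chain_cons P Q h : has_chain P h -> P `<` Q -> is_prime Q ->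
  has_chain Q h.+1.
Proof.
move=> [C [Cp Clt Ch]] PQ Qp.
exists (fun i => if (i <= h)%N then C i else Q); split.
- by move=> i _; case: ifP => // lih; exact: Cp.
- move=> i; rewrite ltnS => lih; rewrite lih; case: ifP => [|]; first exact: Clt.
  move=> /negbT; rewrite -ltnNge ltnS => lhi.
  by have /eqP -> : i == h by [rewrite eqn_leq lih lhi]; rewrite Ch.
- by rewrite ltnn.
Qed.

Lemma has_chain_sub P Q h : has_chain P h -> P `<=` Q -> is_prime Q ->
  has_chain Q h.
Proof.
move=> Ph PQ Qp; have [QP|nQP] := pselect (Q `<=` P).
  by have <- : P = Q by apply/seteqP.
by apply: has_chainW; apply: has_chain_cons Ph _ _.
Qed.

Lemma has_chain0 P : is_prime P -> has_chain P 0.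
Proof. by move=> Pp; exists (fun=> P). Qed.

Lemma height_geS I J h : I `<=` J -> height_ge I h -> height_ge J h.
Proof. by move=> IJ hI P Pp JP; apply: hI => // x /IJ/JP. Qed.

Definition quo I x : set R := [set a | I (a * x)].

Lemma quo_ideal I x : is_ideal I -> is_ideal (quo I x).
Proof.
move=> hI; split=> [|a b|c a]; rewrite /quo /=.
- by rewrite mul0r; exact: ideal_zero.
- by rewrite mulrDl; exact: ideal_add.
- by rewrite -mulrA; exact: ideal_mull.
Qed.

(** The right-hand side says that x lies in I R_P for every prime P of height below h, with
    denominators cleared. It stands in for localization throughout. *)
Lemma height_ge_quoP I x h : is_ideal I ->
  height_ge (quo I x) h <->
  forall P, is_prime P -> ~ has_chain P h -> exists u, ~ P u /\ I (u * x).
Proof.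
move=> hI; split=> [hIx P Pp Ph|hIx P Pp IP].
  apply: contrapT => noU; apply: Ph; apply: (hIx P Pp) => u Iux.
  by apply: contrapT => Pu; apply: noU; exists u.
apply: contrapT => Ph; have [u [Pu Iux]] := hIx P Pp Ph.
by apply: Pu; exact: IP.
Qed.

End IdealTheory.

Section Preimage.
Variables (R S : comNzRingType) (phi : {rmorphism R -> S}).

Lemma preim_ideal (I : set S) : is_ideal I -> is_ideal (phi @^-1` I).
Proof.
move=> hI; split=> [|x y|a x] /=; first by rewrite rmorph0; exact: ideal_zero.
  by rewrite rmorphD; exact: ideal_add.
by rewrite rmorphM; exact: ideal_mull.
Qed.

Lemma preim_prime (P : set S) : is_prime P -> is_prime (phi @^-1` P).
Proof.
move=> Pp; split; first by apply: preim_ideal; exact: prime_ideal.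
  by rewrite /= rmorph1; exact: prime_neq1.
by move=> x y /=; rewrite rmorphM; exact: primeM.
Qed.

End Preimage.

(** The section [psi] makes [phi] surjective, which keeps the inclusions strict. *)
Lemma preim_chain (R S : comNzRingType) (phi : {rmorphism R -> S})
    (psi : S -> R) (P : set S) h :
  cancel psi phi -> has_chain P h -> has_chain (phi @^-1` P) h.
Proof.
move=> psiK [C [Cp Clt Ch]]; exists (fun i => phi @^-1` C i); split.
- by move=> i lih; apply: preim_prime; exact: Cp.
- move=> i lih; have [sub nsub] := Clt i lih; split.
    by move=> x /=; exact: sub.
  by move=> sub'; apply: nsub => y Cy; rewrite -(psiK y); apply: sub';
    rewrite /= psiK.
- by rewrite Ch.
Qed.

(** * Dimension theory of polynomial rings *)

Lemma mpoly_morph_ext (n : nat) (A S : comNzRingType)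
    (phi1 phi2 : {rmorphism {mpoly A[n]} -> S}) :
  (forall c, phi1 c%:MP = phi2 c%:MP) -> (forall i, phi1 'X_i = phi2 'X_i) ->
  phi1 =1 phi2.
Proof.
move=> eqC eqX p; rewrite (mpolyE p) !rmorph_sum /=; apply: eq_bigr => m _.
rewrite -mul_mpolyC !rmorphM eqC mpolyXE_id !rmorph_prod; congr (_ * _).
by apply: eq_bigr => i _; rewrite !rmorphXn /= eqX.
Qed.

Section AlgebraicDependence.
Variable K : fieldType.

Lemma msize_mul_leq n (p q : {mpoly K[n]}) d e :
  (msize p <= d.+1)%N -> (msize q <= e.+1)%N -> (msize (p * q) <= (d + e).+1)%N.
Proof.
move=> pd qe; have [->|p0] := eqVneq p 0; first by rewrite mul0r msize0.
have [->|q0] := eqVneq q 0; first by rewrite mulr0 msize0.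
rewrite msizeM_proper ?mulf_neq0 ?mleadc_eq0 //.
by have := mpolySpred mdeg p0; have := mpolySpred mdeg q0; lia.
Qed.

Lemma msize_exp_leq n (p : {mpoly K[n]}) d k :
  (msize p <= d.+1)%N -> (msize (p ^+ k) <= (d * k).+1)%N.
Proof.
move=> pd; elim: k => [|k IHk]; first by rewrite expr0 msize1 muln0.
by rewrite exprS mulnS; exact: msize_mul_leq.
Qed.

Lemma msize_mmap1_leq n k (F : 'I_k -> {mpoly K[n]}) d (m : 'X_{1..k}) :
  (forall i, (msize (F i) <= d.+1)%N) ->
  (msize (mmap1 F m) <= (d * mdeg m).+1)%N.
Proof.
move=> Fd; rewrite mdegE big_distrr /= /mmap1.
elim/big_rec2: _ => [|i e p _ IH]; first by rewrite msize1.
by apply: msize_mul_leq => //; exact: msize_exp_leq.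
Qed.

Definition box_mnm k M (e : {ffun 'I_k -> 'I_M}) : 'X_{1..k} :=
  [multinom (e i : nat) | i < k].

Lemma box_mnm_inj k M : injective (@box_mnm k M).
Proof.
move=> e e' /mnmP eq_ee'; apply/ffunP => i; apply/val_inj.
by have := eq_ee' i; rewrite !mnmE.
Qed.

(* Pigeonhole: the M^(r+1) monomials of partial degrees below M in r+1        *)
(* polynomials lie in a space of dimension (c M)^r, which is smaller once     *)
(* M > c^r.                                                                   *)
Lemma algebraically_dependent r (F : 'I_r.+1 -> {mpoly K[r]}) :
  exists2 G : {mpoly K[r.+1]}, G != 0 & mmap (@mpolyC r K) F G = 0.
Proof.
pose D := (\max_i msize (F i))%N; pose c := (r.+1 * D).+1.
pose M := (c ^ r).+1; pose B := (c * M)%N.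
have FD i : (msize (F i) <= D.+1)%N by apply: leqW; exact: leq_bigmax.
pose q (a : 'I_#|{ffun 'I_r.+1 -> 'I_M}|) := mmap1 F (box_mnm (enum_val a)).
pose A : 'M[K]_(_, #|{ffun 'I_r -> 'I_B}|) :=
  \matrix_(a, b) (q a)@_(box_mnm (enum_val b)).
have qB a : (msize (q a) <= B)%N.
  apply: leq_trans (msize_mmap1_leq _ FD) _.
  have : (mdeg (box_mnm (enum_val a)) <= r.+1 * M)%N.
    rewrite mdegE -[X in (_ <= X * _)%N]card_ord -sum_nat_const.
    by apply: leq_sum => i _; rewrite mnmE ltnW.
  rewrite /B /c; move: (mdeg _) => d; rewrite /M; move: (c ^ r)%N => N.
  by nia.
have [v v0 vA] : exists2 v : 'rV_#|{ffun 'I_r.+1 -> 'I_M}|, v != 0 & v *m A = 0.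
  have : kermx A != 0.
    rewrite kermx_eq0 /row_free neq_ltn; apply/orP; left.
    apply: leq_ltn_trans (rank_leq_col A) _.
    rewrite !card_ffun !card_ord /B expnMn expnSr.
    by rewrite mulnC ltn_pmul2l ?expn_gt0.
  case/matrix0Pn => i [j ij]; exists (row i (kermx A)).
    by apply/matrix0Pn; exists 0, j; rewrite mxE.
  by rewrite -row_mul mulmx_ker row0.
exists (\sum_a v 0 a *: 'X_[box_mnm (enum_val a)]).
  case/matrix0Pn: v0 => i [a]; rewrite ord1 => va.
  apply: contra_neq va => /mpolyP/(_ (box_mnm (enum_val a))).
  rewrite mcoeff0 raddf_sum /= (bigD1 a) //= mcoeffZ mcoeffX eqxx mulr1.
  rewrite big1 ?addr0 // => b ba; rewrite mcoeffZ mcoeffX.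
  by rewrite (inj_eq (@box_mnm_inj _ _)) (inj_eq enum_val_inj) (negPf ba) mulr0.
rewrite raddf_sum /=; under eq_bigr do rewrite mmapZ mmapX -/(q _).
apply/mpolyP => m; rewrite mcoeff0 raddf_sum /=.
have [mB|[i Bmi]] : (forall i, m i < B)%N \/ exists i, (B <= m i)%N.
  case: (boolP [forall i, m i < B]%N) => [/forallP|/forallPn[i]]; first by left.
  by rewrite -leqNgt; right; exists i.
- pose b : {ffun 'I_r -> 'I_B} := [ffun i => Ordinal (mB i)].
  have -> : m = box_mnm b by apply/mnmP => i; rewrite mnmE ffunE.
  move/matrixP: vA => /(_ 0 (enum_rank b)); rewrite !mxE; apply: etrans.
  by apply: eq_bigr => a _; rewrite mcoeffCM mxE enum_rankK.
- apply: big1 => a _; rewrite mcoeffCM memN_msupp_eq0 ?mulr0 //.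
  apply: msize_mdeg_ge; apply: leq_trans (qB a) (leq_trans Bmi _).
  by rewrite mdegE (bigD1 i) //= leq_addr.
Qed.

End AlgebraicDependence.

(* [shear] is x_i |-> x_i + c_i z for i < m and x_m |-> c_m z. *)
Section Shear.
Variables (K : fieldType) (m : nat) (c : 'I_m.+1 -> K).

Definition shear_var (i : 'I_m.+1) : {poly {mpoly K[m]}} :=
  (if unlift ord_max i is Some j then ('X_(j : 'I_m) : {mpoly K[m]})%:P else 0)
    + ((c i)%:MP : {mpoly K[m]})%:P * 'X.

Definition shear : {mpoly K[m.+1]} -> {poly {mpoly K[m]}} :=
  mmap (polyC \o @mpolyC m K) shear_var.

HB.instance Definition _ := GRing.RMorphism.on shear.

(** On coefficients, the inverse of [shear] when c_m is nonzero: z comes from x_m / c_m, so the c_j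
    z added to x_j is removed as (c_j / c_m) x_m. *)
Definition unshear_coef : {mpoly K[m]} -> {mpoly K[m.+1]} :=
  mmap (@mpolyC m.+1 K)
    (fun j => 'X_(lift ord_max j) - (c (lift ord_max j) / c ord_max) *: 'X_ord_max).

HB.instance Definition _ := GRing.RMorphism.on unshear_coef.

Definition unshear : {poly {mpoly K[m]}} -> {mpoly K[m.+1]} :=
  horner_eval ((c ord_max)^-1 *: 'X_ord_max) \o map_poly unshear_coef.

HB.instance Definition _ := GRing.RMorphism.on unshear.

Lemma shearC a : shear a%:MP = a%:MP%:P.
Proof. by rewrite /shear mmapC. Qed.

Lemma shearZ a p : shear (a *: p) = a%:MP *: shear p.
Proof. by rewrite -mul_mpolyC rmorphM /= shearC mul_polyC. Qed.

Lemma shearX i : shear 'X_i = shear_var i.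
Proof. by rewrite /shear mmapX mmap1U. Qed.

Lemma unshear_polyC p : unshear p%:P = unshear_coef p.
Proof. by rewrite /unshear /= map_polyC /= /horner_eval hornerC. Qed.

Lemma unshear_X : unshear 'X = (c ord_max)^-1 *: 'X_ord_max.
Proof. by rewrite /unshear /= map_polyX /horner_eval hornerX. Qed.

Lemma unshearC a : unshear a%:MP%:P = a%:MP.
Proof. by rewrite unshear_polyC /unshear_coef mmapC. Qed.

Hypothesis c_neq0 : c ord_max != 0.

Lemma shearK : cancel shear unshear.
Proof.
apply: (@mpoly_morph_ext _ _ _ (unshear \o shear) idfun) => [a|i] /=.
  by rewrite shearC unshearC.
rewrite shearX /shear_var rmorphD rmorphM /= unshearC unshear_X.
rewrite mul_mpolyC; case: unliftP => [j ->|->]; last first.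
  by rewrite rmorph0 add0r scalerA mulfV ?scale1r.
rewrite unshear_polyC /unshear_coef mmapX mmap1U -scalerA.
by rewrite subrK.
Qed.

Lemma unshearK : cancel unshear shear.
Proof.
move=> q; rewrite -[q in RHS]coefK -[q in LHS]coefK !poly_def !rmorph_sum /=.
have shearCK p : shear (unshear p%:P) = p%:P.
  apply: (@mpoly_morph_ext _ _ _ (shear \o unshear \o polyC) polyC) => [a|i] /=.
    by rewrite unshearC shearC.
  rewrite unshear_polyC /unshear_coef mmapX mmap1U.
  rewrite -mul_mpolyC rmorphB rmorphM /= shearC !shearX /shear_var.
  rewrite liftK unlift_none add0r mulrA -!polyCM -!mpolyCM.
  by rewrite divfK // addrK.
apply: eq_bigr => i _; rewrite -mul_polyC !rmorphM /= shearCK !rmorphXn /=.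
congr (_ * _ ^+ _); rewrite unshear_X -mul_mpolyC rmorphM /= shearC shearX /shear_var.
by rewrite unlift_none add0r mulrA -polyCM -mpolyCM mulVf // mpolyC1 mul1r.
Qed.

End Shear.

(** Since f is not in the prime C, powers of the variable can be divided out of q until its constant
    term a is nonzero. Then a is q(f) minus a multiple of f, both in C'. *)
Lemma low_coef_in_prime (A R : comNzRingType) (ev : {rmorphism A -> R})
    (C C' : set R) (f : R) (q : {poly A}) :
  is_prime C -> is_ideal C' -> C `<=` C' -> ~ C f -> C' f ->
  q != 0 -> C (map_poly ev q).[f] -> exists2 a, a != 0 & C' (ev a).
Proof.
move=> Cp hC' CC' Cf C'f; elim/poly_ind: q => [|q a IHq]; first by rewrite eqxx.
rewrite rmorphD rmorphM /= map_polyX map_polyC !hornerE /=.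
have [->|a0 _ Cqa] := eqVneq a 0; last first.
  exists a => //; have -> : ev a = ((map_poly ev q).[f] * f + ev a)
    - (map_poly ev q).[f] * f by rewrite addrC addKr.
  by apply: ideal_sub => //; [exact: CC'|exact: ideal_mull].
rewrite polyC0 rmorph0 !addr0 => qX0 /(primeM Cp) [|//]; apply: IHq.
by apply: contraNneq qX0 => ->; rewrite mul0r.
Qed.

Section Dimension.
Variable K : fieldType.

(* F is indexed by nat so that the number n of variables can vary freely. *)
Definition evalN r (F : nat -> {mpoly K[r]}) n : {mpoly K[n]} -> {mpoly K[r]} :=
  mmap (@mpolyC r K) (fun i : 'I_n => F i).

HB.instance Definition _ r F n := GRing.RMorphism.on (@evalN r F n).

Lemma evalNC r F n a : @evalN r F n a%:MP = a%:MP.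
Proof. by rewrite /evalN mmapC. Qed.

Lemma evalNX r F n (i : 'I_n) : @evalN r F n 'X_i = F i.
Proof. by rewrite /evalN mmapX mmap1U. Qed.

(** For this choice of c, [shear] only splits off the last variable. *)
Lemma evalN_shear r (F : nat -> {mpoly K[r]}) n (G : {mpoly K[n.+1]}) :
  evalN F G =
  (map_poly (@evalN r F n) (shear (fun i => (i == ord_max)%:R) G)).[F n].
Proof.
set sh := shear _.
apply: (@mpoly_morph_ext _ _ _ (@evalN r F n.+1)
  (horner_eval (F n) \o map_poly (@evalN r F n) \o sh)) => [a|i] /=.
  rewrite /sh shearC map_polyC /horner_eval hornerC evalNC.
  exact/esym/evalNC.
rewrite /sh shearX /shear_var evalNX.
rewrite rmorphD rmorphM /= map_polyX !map_polyC /= /horner_eval !hornerE.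
case: unliftP => [j ->|->].
  rewrite eq_sym (negPf (neq_lift _ _)) evalNC mpolyC0 mul0r addr0.
  by rewrite map_polyC hornerC [in RHS]/= (evalNX _ (j : 'I_n)) lift_max.
by rewrite rmorph0 horner0 add0r eqxx evalNC mpolyC1 mul1r.
Qed.

(* Dimension theory without transcendence degrees: pick f_i in C_i but not in *)
(* C_(i-1). A relation between the f_i and the y_j = iota X_j can be divided  *)
(* by powers of f_1, .., f_h in turn, until it becomes one between the y_j.   *)
Lemma chain_bound r k h (P : set {mpoly K[r]})
    (iota : {rmorphism {mpoly K[k]} -> {mpoly K[r]}}) :
  (forall c, iota c%:MP = c%:MP) -> (forall G, P (iota G) -> G = 0) ->
  (h + k = r.+1)%N -> ~ has_chain P h.
Proof.
move=> iotaC iotaP hk [C [Cp Clt Ch]].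
have /choice[f fP] : forall j, exists f, (j < h)%N -> C j.+1 f /\ ~ C j f.
  move=> j; case: (boolP (j < h)%N) => [ljh|_]; last by exists 0.
  have [sub nsub] := Clt j ljh; apply: contrapT => nof.
  apply: nsub => f Cf; apply: contrapT => nCf; apply: nof; by exists f.
(* The f_j follow the y_i in reverse order, so that f_j is the value of the last variable, the one
   split off at step j. *)
pose F i := if insub i is Some i' then iota 'X_(i' : 'I_k) else f (h - (i - k).+1)%N.
have F_low : @evalN r F k =1 iota.
  apply: (@mpoly_morph_ext _ _ _ (@evalN r F k) iota) => [c|i].
    exact: etrans (evalNC _ _ _) (esym (iotaC _)).
  by apply: etrans (evalNX _ _) _; rewrite /F valK.
have F_high j : F (j + k)%N = f (h - j.+1)%N.
  by rewrite /F insubF ?addnK // ltnNge leq_addl.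
have step j : (j <= h)%N ->
    exists2 G : {mpoly K[(h - j) + k]}, G != 0 & C j (evalN F G).
  elim: j => [_|j IHj ljh].
    have [G G0 FG] := algebraically_dependent (fun i : 'I_r.+1 => F i).
    rewrite subn0 hk; exists G => //; rewrite [evalN _ _]FG.
    by apply: ideal_zero; apply: prime_ideal; exact: Cp.
  have [] := IHj (ltnW ljh); rewrite -(subSS j h) subSn // addSn => G G0 CG.
  have [Cf nCf] := fP j ljh.
  have fE : F (h - j.+1 + k)%N = f j by rewrite F_high -subSn // subSS subKn // ltnW.
  have := CG; rewrite evalN_shear fE.
  apply: low_coef_in_prime; rewrite ?fE //.
  - by apply: Cp; exact: ltnW.
  - by apply: prime_ideal; exact: Cp.
  - by have [] := Clt j ljh.
  - by apply: contra_neq G0 => shG; rewrite -(@shearK _ _ (fun i => (i == ord_max)%:R) _ G)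
      ?shG ?rmorph0 ?eqxx ?oner_neq0.
have [] := step h (leqnn h); rewrite subnn add0n => G G0.
by rewrite Ch F_low => /iotaP /eqP; rewrite (negPf G0).
Qed.

(** Otherwise the nonzero elements of the subring form a multiplicative set disjoint from I. A prime
    containing I and avoiding this set has height at least h, against [chain_bound]. *)
Lemma height_elimination r k h (I : set {mpoly K[r]})
    (iota : {rmorphism {mpoly K[k]} -> {mpoly K[r]}}) :
  (forall c, iota c%:MP = c%:MP) -> injective iota -> is_ideal I ->
  (h + k = r.+1)%N -> height_ge I h -> exists2 G, G != 0 & I (iota G).
Proof.
move=> iotaC iota_inj hI hk ht; apply: contrapT => noG.
pose E := [set x | exists2 G, G != 0 & x = iota G].
have [||x Ix [G G0 xE]|P [Pp IP PE]] := @prime_avoiding _ I E hI.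
- by exists 1; rewrite ?oner_neq0 ?rmorph1.
- move=> _ _ [G G0 ->] [G' G'0 ->]; exists (G * G'); first by rewrite mulf_neq0.
  by rewrite rmorphM.
- by apply: noG; exists G => //; rewrite -xE.
apply: (chain_bound iotaC _ hk (ht P Pp IP)) => G PG; apply/eqP.
by apply: contrapT => /negP G0; apply: (PE _ PG); exists G.
Qed.

End Dimension.

Lemma mcoeff_pihomog (K : fieldType) n d (p : {mpoly K[n]}) mm :
  (pihomog mdeg d p)@_mm = if mdeg mm == d then p@_mm else 0.
Proof.
rewrite pihomogE raddf_sum /= [p in RHS](mpolyE p) raddf_sum /= big_mkcond /=.
have [mmd|mmd] := boolP (mdeg mm == d); last first.
  rewrite big1 // => m' _; case: ifP => // m'd; rewrite mcoeffZ mcoeffX.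
  by case: eqP => [m'E|_]; [rewrite -m'E m'd in mmd|rewrite mulr0].
apply: eq_bigr => m' _; rewrite mcoeffZ mcoeffX.
by case: ifP => // m'd; case: eqP => [m'E|_]; [rewrite m'E mmd in m'd|rewrite mulr0].
Qed.

(** * Linear changes of coordinates that make a polynomial monic *)

Section MonicCoordinates.
Variable K : closedFieldType.

Lemma morph_meval n (phi : {rmorphism {mpoly K[n]} -> K}) :
  (forall c, phi c%:MP = c) -> forall p, phi p = p.@[fun i => phi 'X_i].
Proof.
move=> phiC; apply: (@mpoly_morph_ext _ _ _ phi (meval _)) => [c|i] /=.
  by rewrite mevalC.
by rewrite mevalXU.
Qed.

Lemma shear_point m (c : 'I_m.+1 -> K) (v : 'I_m -> K) x :
  exists w, forall p, (map_poly (meval v) (shear c p)).[x] = p.@[w].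
Proof.
pose phi : {mpoly K[m.+1]} -> K :=
  horner_eval x \o map_poly (meval v) \o shear c.
pose phiR : {rmorphism {mpoly K[m.+1]} -> K} := phi.
exists (fun i => phi 'X_i); apply: (@morph_meval _ phiR) => a /=.
by rewrite shearC map_polyC /= mevalC /horner_eval hornerC.
Qed.

(** By induction there is a point where the leading coefficient in the last variable does not
    vanish; a nonzero polynomial in one variable over K then has a nonroot. *)
Lemma mpoly_nonroot n (p : {mpoly K[n]}) : p != 0 -> exists v, p.@[v] != 0.
Proof.
elim: n p => [|m IHm] p p0.
  exists (fun=> 0); have pE : p = (p@_0)%:MP.
    apply/mpolyP => mm; rewrite mcoeffC.
    have -> : mm = 0%MM; first by apply/mnmP => -[].
    by rewrite eqxx mulr1.
  by move: p0; rewrite pE mpolyC_eq0 mevalC.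
pose c (i : 'I_m.+1) : K := (i == ord_max)%:R.
have c0 : c ord_max != 0 by rewrite /c eqxx oner_neq0.
have q0 : shear c p != 0.
  by apply: contra_neq p0 => q0; rewrite -(shearK c0 p) q0 rmorph0.
have [|v lv] := IHm (lead_coef (shear c p)); first by rewrite lead_coef_eq0.
have qv0 : map_poly (meval v) (shear c p) != 0.
  apply: contra_neq lv => /(congr1 (fun q : {poly K} => q`_(size (shear c p)).-1)).
  by rewrite coef_map coef0.
have /closed_nonrootP[x] := qv0.
by have [w wP] := shear_point c v x; exists w; rewrite -wP.
Qed.

(** As e may be 0, this only bounds the degree in z and records the coefficient of z^d. *)
Definition shear_top n d (e : K) (q : {poly {mpoly K[n]}}) :=
  (size q <= d.+1)%N /\ q`_d = e%:MP.

Lemma shear_topM n d d' (e e' : K) (q q' : {poly {mpoly K[n]}}) :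
  shear_top d e q -> shear_top d' e' q' -> shear_top (d + d') (e * e') (q * q').
Proof.
move=> [sq qd] [sq' qd']; split.
  apply: leq_trans (size_polyMleq _ _) _.
  have : (size q + size q' <= d.+1 + d'.+1)%N by exact: leq_add.
  by rewrite addSn addnS; case: (_ + _)%N.
have ltd : (d < (d + d').+1)%N by rewrite ltnS leq_addr.
rewrite coefM (bigD1 (Ordinal ltd)) //= addKn qd qd' mpolyCM big1 ?addr0 // => i.
rewrite -val_eqE /= neq_ltn => /orP[lid|ldi].
  rewrite [X in _ * X]nth_default ?mulr0 //; apply: leq_trans sq' _; lia.
by rewrite [X in X * _]nth_default ?mul0r //; apply: leq_trans sq _.
Qed.

Lemma shear_topX n d (e : K) (q : {poly {mpoly K[n]}}) k :
  shear_top d e q -> shear_top (d * k) (e ^+ k) (q ^+ k).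
Proof.
move=> qd; elim: k => [|k IHk]; last by rewrite !exprS mulnS; exact: shear_topM.
by rewrite !expr0 muln0; split; rewrite ?size_poly1 // coef1 mpolyC1.
Qed.

Lemma shear_top_var m (c : 'I_m.+1 -> K) i : shear_top 1 (c i) (shear_var c i).
Proof.
split; last first.
  rewrite coefD coefMX coefC /=; case: unlift => [j|]; rewrite ?coefC ?coef0 add0r //.
apply: leq_trans (size_polyD _ _) _; rewrite geq_max; apply/andP; split.
  by case: unlift => [j|]; rewrite ?size_polyC ?size_poly0 //; case: (_ != 0).
by rewrite mul_polyC; apply: leq_trans (size_scale_leq _ _) _; rewrite size_polyX.
Qed.

Lemma shear_top_mnm m (c : 'I_m.+1 -> K) (mm : 'X_{1..m.+1}) :
  shear_top (mdeg mm) (mmap1 c mm) (shear c 'X_[mm]).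
Proof.
rewrite /shear mmapX mdegE /mmap1.
elim/big_rec3: _ => [|i q e d _ IH].
  by split; rewrite ?size_poly1 // coef1 mpolyC1.
apply: shear_topM => //.
by have := shear_topX (mm i) (shear_top_var c i); rewrite mul1n.
Qed.

Lemma shear_top_deg m (c : 'I_m.+1 -> K) (p : {mpoly K[m.+1]}) d :
  (msize p <= d.+1)%N -> shear_top d (pihomog mdeg d p).@[c] (shear c p).
Proof.
move=> pd; rewrite [p in shear c p](mpolyE p).
have -> : pihomog mdeg d p = \sum_(mm <- msupp p) p@_mm *: pihomog mdeg d 'X_[mm].
  by rewrite [p in LHS](mpolyE p) raddf_sum /=; apply: eq_bigr => mm _; rewrite linearZ.
rewrite !rmorph_sum /= !big_seq.
elim/big_rec2: _ => [|mm e q /msize_mdeg_lt mmp [sq qd]].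
  by split; rewrite ?size_poly0 // coef0 mpolyC0.
have [sX Xd] := shear_top_mnm c mm.
have {mmp} mmd : (mdeg mm <= d)%N by rewrite -ltnS; exact: leq_trans pd.
rewrite shearZ; split.
  apply: leq_trans (size_polyD _ _) _; rewrite geq_max sq andbT.
  by apply: leq_trans (size_scale_leq _ _) (leq_trans sX _).
rewrite coefD qd coefZ mevalZ pihomogX; have [<-|dmm] := eqVneq (mdeg mm) d.
  rewrite Xd /meval mmapX -mpolyCM -mpolyCD; congr (_%:MP); congr (_ * _ + _).
rewrite meval0 mulr0 add0r nth_default ?mulr0 ?add0r //.
by apply: leq_trans sX _; rewrite ltn_neqAle dmm.
Qed.

(* The leading coefficient is the value at c of the top degree form of p. *)
Lemma monic_coordinates m (p : {mpoly K[m.+1]}) : p != 0 ->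
  exists c : 'I_m.+1 -> K, exists2 a, a != 0 &
    c ord_max != 0 /\ shear c (a%:MP * p) \is monic.
Proof.
move=> p0; pose d := (msize p).-1; pose q := pihomog mdeg d p.
have pd : msize p = d.+1 by exact: mpolySpred.
have q0 : q != 0.
  apply/eqP => /mpolyP/(_ (mlead p)); apply/eqP; rewrite mcoeff0 mcoeff_pihomog.
  by rewrite -(eqn_add2r 1) !addn1 mlead_deg // pd eqxx mleadc_eq0.
(* The factor ['X_ord_max] ensures that c_m is nonzero, hence that [shear c] is invertible. *)
have [|c] := @mpoly_nonroot _ ('X_ord_max * q).
  by rewrite mulf_neq0 // -msize_poly_eq0 msizeX.
rewrite mevalM mevalXU mulf_eq0 negb_or => /andP[c0 qc0].
exists c, (q.@[c])^-1; rewrite ?invr_eq0 //; split=> //.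
have [sp pcd] := @shear_top_deg _ c p d (eq_leq pd).
have [_ qd] : shear_top (0 + d) ((q.@[c])^-1 * q.@[c]) (shear c ((q.@[c])^-1%:MP * p)).
  rewrite rmorphM /=; apply: shear_topM; last by [].
  by rewrite shearC; split; rewrite ?size_polyC_leq1 // coefC.
rewrite add0n mulVf // mpolyC1 in qd.
have sd : size (shear c (q.@[c]^-1%:MP * p)) = d.+1.
  apply/eqP; rewrite eqn_leq; apply/andP; split.
    rewrite rmorphM /= shearC mul_polyC; exact: leq_trans (size_scale_leq _ _) sp.
  by rewrite ltnNge; apply/negP => /(nth_default 0) /eqP; rewrite qd oner_eq0.
by rewrite monicE lead_coefE sd qd.
Qed.

End MonicCoordinates.

(** * Unmixedness for one and two generators *)

Section MonicDivision.
Variable B : comNzRingType.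
Implicit Types (a b p q r u v x : {poly B}) (e N : B).

Lemma monic_div a v : a \is monic ->
  exists q r, v = q * a + r /\ (size r < size a)%N.
Proof.
move=> am; exists (Pdiv.Ring.rdivp v a), (Pdiv.Ring.rmodp v a).
by split; [exact: Pdiv.RingMonic.rdivp_eq|exact: Pdiv.Ring.ltn_rmodpN0 (monic_neq0 am)].
Qed.

Lemma monic_mul_small a q : a \is monic -> (size (q * a)%R < size a)%N -> q = 0.
Proof.
move=> am; have [//|q0] := eqVneq q 0.
have := q0; rewrite size_Mmonic // -size_poly_gt0.
by case: (size q) => // k _; rewrite addSn /= ltnNge leq_addl.
Qed.

Lemma dvd_coefs e p : (forall i, exists y, p`_i = e * y) -> exists r, p = e%:P * r.
Proof.
move=> /choice[y py]; exists (\poly_(i < size p) y i).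
apply/polyP => i; rewrite coefCM coef_poly.
by case: ltnP => [_|si]; [exact: py|rewrite nth_default ?mulr0].
Qed.

(** Writing x = q a + r gives (u - e q) a = e r, of degree less than that of a, whence u = e q. *)
Lemma monic_regular a e x u : a \is monic -> e%:P * x = u * a ->
  exists u', u = e%:P * u'.
Proof.
move=> am exu; have [q [r [xE sr]]] := monic_div x am.
exists q; apply/eqP; rewrite -subr_eq0; apply/eqP; apply: (monic_mul_small am).
have -> : (u - e%:P * q) * a = e%:P * r by rewrite mulrBl -exu xE; ring.
by rewrite mul_polyC; exact: leq_ltn_trans (size_scale_leq _ _) sr.
Qed.

(* If N is regular modulo e and lies in (a, b), then b is regular modulo      *)
(* (a, e): B[z]/(a, e) is free over B/e. *)
Lemma monic_regular2 a b e N al be v x u : a \is monic ->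
  (forall y z, e * y = N * z -> exists z', z = e * z') ->
  N%:P = al * a + be * b -> v * b = e%:P * x + u * a ->
  exists q r, v = q * a + e%:P * r.
Proof.
move=> am Nreg NE vb; have [q [r [vE sr]]] := monic_div v am.
have [w1 [w2 [wE sw]]] := monic_div (be * x) am.
(* Modulo a, N v is be (v b), hence e be x; both sides are now compared through their remainders r
   and w2. *)
have NrE : N%:P * r - e%:P * w2 = (al * v + be * u - N%:P * q + e%:P * w1) * a.
  have -> : w2 = be * x - w1 * a by rewrite wE addrC addKr.
  have -> : N%:P * r = N%:P * v - N%:P * q * a by rewrite vE; ring.
  have -> : N%:P * v = al * a * v + be * (v * b) by rewrite NE; ring.
  by rewrite vb; ring.
have small : (size (N%:P * r - e%:P * w2)%R < size a)%N.
  apply: leq_ltn_trans (size_polyD _ _) _; rewrite gtn_max size_polyN !mul_polyC.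
  by rewrite !(leq_ltn_trans (size_scale_leq _ _)).
rewrite NrE in small; rewrite (monic_mul_small am small) mul0r in NrE.
have [r' rE] : exists r', r = e%:P * r'.
  apply: dvd_coefs => i; apply: (Nreg w2`_i).
  by move/eqP: NrE; rewrite subr_eq0 => /eqP/polyP/(_ i); rewrite !coefCM.
by exists q, r'; rewrite vE rE.
Qed.

(** By [monic_regular2], v = q a + e r, so that e (x - r b) = (u + q b) a; by [monic_regular], e
    divides u + q b and can be cancelled. *)
Lemma monic_regular3 a b e N al be x u v : a \is monic -> GRing.lreg e ->
  (forall y z, e * y = N * z -> exists z', z = e * z') ->
  N%:P = al * a + be * b -> e%:P * x = u * a + v * b ->
  exists u' v', x = u' * a + v' * b.
Proof.
move=> am ereg Nreg NE xE.
have vb : v * b = e%:P * x + (- u) * a by rewrite xE; ring.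
have [q [r vE]] := monic_regular2 am Nreg NE vb.
have : e%:P * (x - r * b) = (u + q * b) * a by rewrite mulrBr xE vE; ring.
move=> H; have [u' uE] := monic_regular am H.
exists u', r; apply/eqP; rewrite -subr_eq0; apply/eqP/polyP => i.
apply: ereg; rewrite coef0 mulr0 -coefCM.
have -> : e%:P * (x - (u' * a + r * b)) = e%:P * (x - r * b) - e%:P * u' * a by ring.
by rewrite H uE subrr coef0.
Qed.

Definition poly_ext (C : set B) : set {poly B} := [set p | forall i, C p`_i].

Lemma poly_ext_prime (C : set B) : is_prime C -> is_prime (poly_ext C).
Proof.
move=> Cp; have hC := prime_ideal Cp; split.
- split=> [i|x y Cx Cy i|a x Cx i]; first by rewrite coef0; exact: ideal_zero.
    by rewrite coefD; exact: ideal_add.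
  by rewrite coefM; apply: ideal_sum => // j _; exact: ideal_mull.
- by move=> /(_ 0%N); rewrite coef1; exact: prime_neq1.
- move=> x y Cxy; apply: contrapT => /not_orP[].
  move=> /existsNP[i0 Cx0] /existsNP[j0 Cy0].
  have ex0 : exists i, `[< ~ C x`_i >] by exists i0; apply/asboolP.
  have ey0 : exists i, `[< ~ C y`_i >] by exists j0; apply/asboolP.
  case: (ex_minnP ex0) => i /asboolP Cxi imin.
  case: (ex_minnP ey0) => j /asboolP Cyj jmin.
  have lti : (i < (i + j).+1)%N by rewrite ltnS leq_addr.
  have := Cxy (i + j)%N; rewrite coefM (bigD1 (Ordinal lti)) //= addKn => Cs.
  suff : C (x`_i * y`_j) by exact: primeMN.
  rewrite -(addrK (\sum_(k < (i + j).+1 | k != Ordinal lti)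
    x`_k * y`_(i + j - k)) (_ * _)); apply: ideal_sub Cs _ => //.
  apply: ideal_sum => // k.
  rewrite -val_eqE /= neq_ltn => /orP[lki|lik].
    apply: (ideal_mulr _ hC); apply: contrapT => Cxk.
    by have := imin k (asboolT Cxk); rewrite leqNgt lki.
  apply: (ideal_mull _ hC); apply: contrapT => Cyk.
  by have := jmin _ (asboolT Cyk); have := ltn_ord k; lia.
Qed.

(** The primes of the chain extend to B[z], and the last extension lies strictly below P because it
    does not contain the monic a. *)
Lemma poly_ext_chain (P : set {poly B}) a h : is_prime P -> a \is monic -> P a ->
  has_chain (polyC @^-1` P) h -> has_chain P h.+1.
Proof.
move=> Pp am Pa [C [Cp Clt Ch]].
have CP : poly_ext (C h) `<=` P.
  move=> p Cp'; rewrite -[p]coefK poly_def.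
  apply: ideal_sum; first exact: prime_ideal.
  move=> i _; rewrite -mul_polyC; apply: ideal_mulr; first exact: prime_ideal.
  by have := Cp' i; rewrite Ch.
apply: (@has_chain_cons _ (poly_ext (C h))) => //.
  exists (fun i => poly_ext (C i)); split=> //.
    by move=> i lih; apply: poly_ext_prime; exact: Cp.
  move=> i lih; have [sub nsub] := Clt i lih; split.
    by move=> p Cp' k; exact: sub.
  move=> sub'; apply: nsub => x Cx.
  have := sub' x%:P; move=> /(_ _ 0%N); rewrite coefC; apply=> k.
  by rewrite coefC; case: eqP => // _; apply: ideal_zero; apply: prime_ideal; exact: Cp.
split=> // sub; have := sub _ Pa (size a).-1.
rewrite -lead_coefE (monicP am); apply: prime_neq1; exact: Cp.
Qed.

End MonicDivision.

Lemma zero_prime (R : idomainType) : is_prime [set 0 : R].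
Proof.
split; first by split=> [//|x y -> ->|a x ->] /=; rewrite ?addr0 ?mulr0.
  by move=> /= /eqP; rewrite oner_eq0.
by move=> x y /= /eqP; rewrite mulf_eq0 => /orP[] /eqP; [left|right].
Qed.

Lemma has_chain1 (R : idomainType) (P : set R) x :
  is_prime P -> P x -> x != 0 -> has_chain P 1.
Proof.
move=> Pp Px x0; apply: (has_chain_cons (has_chain0 (zero_prime R)) _ Pp).
split; first by move=> y ->; exact: ideal_zero (prime_ideal Pp).
by move=> /(_ _ Px) /= xE; rewrite xE eqxx in x0.
Qed.

(* The elements of s generate the maximal ideal of the local ring R_P. *)
Definition locally_generated (R : comNzRingType) (P : set R) (s : seq R) : Prop :=
  (forall p, p \in s -> P p) /\
  forall q, P q -> exists u, ~ P u /\ ideal_gen s (u * q).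

Lemma common_denominator (R : comNzRingType) (P I : set R) n (x : 'I_n -> R) :
  is_prime P -> is_ideal I -> (forall i, exists u, ~ P u /\ I (u * x i)) ->
  exists u, ~ P u /\ forall i, I (u * x i).
Proof.
move=> Pp hI /choice[u uP]; exists (\prod_i u i); split.
  by apply: prime_prodN => // i _; case: (uP i).
move=> i; rewrite (bigD1 i) //= mulrAC; apply: ideal_mulr => //.
by case: (uP i).
Qed.

Lemma ideal_gen_map (R S : comNzRingType) (phi : {rmorphism R -> S}) s x :
  ideal_gen s x -> ideal_gen (map phi s) (phi x).
Proof.
move=> [c ->]; rewrite rmorph_sum; exists (phi \o c).
rewrite size_map; apply: eq_bigr => i _.
by rewrite rmorphM (nth_map 0).
Qed.

Lemma ideal_gen_cons_sub (R : comNzRingType) a (s : seq R) :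
  ideal_gen s `<=` ideal_gen (a :: s).
Proof.
by move=> x sx; apply/ideal_gen_consP; exists 0, x; rewrite ?mul0r ?add0r.
Qed.

Lemma locally_generated_preim (R S : comNzRingType) (phi : {rmorphism R -> S})
    (psi : {rmorphism S -> R}) (P : set S) s : cancel psi phi ->
  locally_generated (phi @^-1` P) s -> locally_generated P (map phi s).
Proof.
move=> psiK [sP Pgen]; split.
  by move=> _ /mapP[x xs ->]; exact: sP.
move=> q Pq; have [|u [Pu uq]] := Pgen (psi q); first by rewrite /= psiK.
exists (phi u); split=> //.
by rewrite -[q]psiK -rmorphM; exact: ideal_gen_map.
Qed.

(* A polynomial of P of least degree among those with leading coefficient     *)
(* outside P :&: B is the missing generator, by pseudo-division. *)
Lemma locally_generated_poly (B : idomainType) (P : set {poly B}) a s :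
  is_prime P -> a \is monic -> P a -> locally_generated (polyC @^-1` P) s ->
  exists G, locally_generated P (G :: map polyC s).
Proof.
move=> Pp am Pa [sP Pgen]; have hP := prime_ideal Pp.
pose good k := exists p, [/\ P p, ~ P (lead_coef p)%:P & size p = k].
have [|k /asboolP[G [PG lG sG]] kmin] := @ex_minnP (fun k => `[< good k >]).
  exists (size a); apply/asboolP; exists a; split=> //.
  by rewrite (monicP am) => /(prime_neq1 Pp).
have G0 : G != 0 by apply/eqP => GE; apply: lG; rewrite GE lead_coef0 polyC0; exact: ideal_zero.
exists G; split.
  by move=> p; rewrite inE => /predU1P[-> //|/mapP[x xs ->]]; exact: sP.
move=> q Pq; pose l := lead_coef G ^+ Pdiv.Ring.rscalp q G.
pose h := Pdiv.Ring.rdivp q G; pose r := Pdiv.Ring.rmodp q G.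
have qE : q * l%:P = h * G + r.
  by apply: Pdiv.RingComRreg.rdivp_eq; exact: mulrC.
have sr : (size r < size G)%N by exact: Pdiv.Ring.ltn_rmodpN0.
have Pr : P r.
  have -> : r = q * l%:P - h * G by rewrite qE addrC addKr.
  by apply: ideal_sub => //; [exact: ideal_mulr|exact: ideal_mull].
(* By minimality of the degree of G, the leading coefficient of p lies in P; removing the leading
   term and repeating puts all the coefficients in P. *)
have coefP n (p : {poly B}) : (size p <= n)%N -> (size p < size G)%N -> P p ->
    forall i, P (p`_i)%:P.
  elim: n p => [|n IHn] p.
    by rewrite leqn0 size_poly_eq0 => /eqP -> _ _ i; rewrite coef0 polyC0; exact: ideal_zero.
  move=> spn spG Pp' i; have [lp|nlp] := pselect (P (lead_coef p)%:P); last first.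
    have : (size G <= size p)%N.
      by rewrite sG; apply: kmin; apply/asboolP; exists p; split.
    by rewrite leqNgt spG.
  have [p0|p0] := eqVneq p 0; first by rewrite p0 coef0 polyC0; exact: ideal_zero.
  have sp0 : (0 < size p)%N by rewrite size_poly_gt0.
  pose p' := p - (lead_coef p)%:P * 'X^((size p).-1).
  have p'E j : p'`_j = if j == (size p).-1 then 0 else p`_j.
    rewrite coefB coefCM coefXn; case: eqP => [->|_]; last by rewrite mulr0 subr0.
    by rewrite mulr1 lead_coefE subrr.
  have sp' : (size p' <= (size p).-1)%N.
    apply/leq_sizeP => j lj; rewrite p'E; case: eqP => // /eqP jn.
    by rewrite nth_default // -(prednK sp0) ltn_neqAle eq_sym jn.
  have Pp'' : P p' by apply: ideal_sub => //; exact: ideal_mulr.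
  have := IHn p' _ _ Pp'' i; rewrite p'E; case: eqP => [iE|_]; first by rewrite iE -lead_coefE.
  by apply; move: sp' sp0 spn spG; lia.
have {}coefP i : P (r`_i)%:P by exact: (coefP (size r)).
have [u [Pu ur]] : exists u, ~ P u%:P /\ forall i : 'I_(size r), ideal_gen s (u * r`_i).
  apply: (@common_denominator _ (polyC @^-1` P) (ideal_gen s) (size r) (fun i => r`_i)).
  - exact: preim_prime.
  - exact: ideal_gen_ideal.
  - by move=> i; exact: Pgen.
have ur' : ideal_gen (map polyC s) (u%:P * r).
  rewrite -[r]coefK poly_def mulr_sumr.
  apply: ideal_sum => [|i _]; first exact: ideal_gen_ideal.
  rewrite -mul_polyC mulrA -polyCM; apply: ideal_mulr; first exact: ideal_gen_ideal.
  exact: ideal_gen_map.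
exists (u%:P * l%:P); split.
  apply: primeMN => //; rewrite /l polyC_exp.
  exact: primeXN.
apply/ideal_gen_consP; exists (u%:P * h), (u%:P * r) => //.
by rewrite -mulrA [X in _ * X]mulrC qE; ring.
Qed.

Lemma locally_generated0 (R : comNzRingType) (P : set R) : is_prime P ->
  (forall x, P x -> x = 0) -> locally_generated P [::].
Proof.
move=> Pp P0; split=> // q /P0 ->; exists 1; split; first exact: prime_neq1.
by rewrite mulr0; exact: ideal_zero (ideal_gen_ideal _).
Qed.

Lemma no_chain_zero (R : idomainType) (P : set R) : is_prime P ->
  ~ has_chain P 1 -> forall x, P x -> x = 0.
Proof.
by move=> Pp nP x Px; apply: contrapT => /eqP x0; apply: nP; exact: has_chain1 Px x0.
Qed.

(** * Transport to a ring R isomorphic to A[z] *)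

Section PolynomialPresentation.
Variables (A R : idomainType).
Variables (phi : {rmorphism R -> {poly A}}) (psi : {rmorphism {poly A} -> R}).
Variable iota : {rmorphism A -> R}.
Hypotheses (phiK : cancel phi psi) (psiK : cancel psi phi).
Hypothesis iotaE : forall x, iota x = psi x%:P.
Implicit Types (P : set R) (a b x u v : R) (e : A).

Lemma present_iota e : phi (iota e) = e%:P.
Proof. by rewrite iotaE psiK. Qed.

Lemma present_iota_inj : injective iota.
Proof. by move=> x y; rewrite !iotaE => /(can_inj psiK)/polyC_inj. Qed.

Lemma present_preim P : polyC @^-1` (psi @^-1` P) = iota @^-1` P.
Proof. by apply/funext => x /=; rewrite iotaE. Qed.

Lemma present_chain P a h : is_prime P -> phi a \is monic -> P a ->
  has_chain (iota @^-1` P) h -> has_chain P h.+1.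
Proof.
move=> Pp am Pa Ph.
have -> : P = phi @^-1` (psi @^-1` P) by apply/funext => p /=; rewrite phiK.
apply: (@preim_chain _ _ phi psi _ _ psiK).
apply: poly_ext_chain am _ _; first exact: preim_prime.
  by rewrite /= phiK.
by rewrite present_preim.
Qed.

Lemma present_locally_generated P a s : is_prime P -> phi a \is monic -> P a ->
  locally_generated (iota @^-1` P) s ->
  exists G, locally_generated P (G :: map iota s).
Proof.
move=> Pp am Pa Ps.
have [|||G Gs] := @locally_generated_poly _ (psi @^-1` P) (phi a) s _ am.
- exact: preim_prime.
- by rewrite /= phiK.
- by rewrite present_preim.
exists (psi G); have := locally_generated_preim phiK Gs.
rewrite /= -map_comp; congr (locally_generated _ (_ :: _)).
by apply: eq_map => x /=; rewrite iotaE.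
Qed.

Lemma present_regular a e x u : phi a \is monic -> iota e * x = u * a ->
  exists u', u = iota e * u'.
Proof.
move=> am /(congr1 phi); rewrite !rmorphM present_iota => /(monic_regular am)[u' uE].
by exists (psi u'); rewrite -(phiK u) uE rmorphM iotaE.
Qed.

Lemma present_torsion_free a e x : phi a \is monic -> e != 0 ->
  ideal_gen [:: a] (iota e * x) -> ideal_gen [:: a] x.
Proof.
move=> am e0 /ideal_gen1P[u eu]; have [u' uE] := present_regular am eu.
apply/ideal_gen1P; exists u'.
have /mulfI : iota e != 0 by rewrite -(rmorph0 iota) (inj_eq present_iota_inj).
by apply; rewrite eu uE mulrA.
Qed.

Section TwoGenerators.
Variables (a b : R) (N : A).
Hypotheses (am : phi a \is monic) (abN : ideal_gen [:: a; b] (iota N)).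
Variable e : A.
Hypothesis Nreg : forall y z, e * y = N * z -> exists z', z = e * z'.

Let N_mem : exists al be, N%:P = al * phi a + be * phi b.
Proof.
case/ideal_gen2P: abN => al [be /(congr1 phi)].
rewrite present_iota rmorphD !rmorphM => ->.
by exists (phi al), (phi be).
Qed.

Lemma present_regular2 v x u : v * b = iota e * x + u * a ->
  exists q r, v = q * a + iota e * r.
Proof.
move=> /(congr1 phi); rewrite rmorphD !rmorphM present_iota => vb.
have [al [be NE]] := N_mem.
have [q [r vE]] := monic_regular2 am Nreg NE vb.
by exists (psi q), (psi r); rewrite -(phiK v) vE rmorphD !rmorphM phiK iotaE.
Qed.

Lemma present_torsion_free2 x : e != 0 ->
  ideal_gen [:: a; b] (iota e * x) -> ideal_gen [:: a; b] x.
Proof.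
move=> e0 /ideal_gen2P[u [v /(congr1 phi)]].
rewrite rmorphD !rmorphM present_iota => xE.
have [al [be NE]] := N_mem.
have [u' [v' xE']] := monic_regular3 am (mulfI e0) Nreg NE xE.
apply/ideal_gen2P; exists (psi u'), (psi v').
by rewrite -(phiK x) xE' rmorphD !rmorphM !phiK.
Qed.

End TwoGenerators.
End PolynomialPresentation.

Section Unmixedness.
Variable K : closedFieldType.

Lemma unshear_coefE m (c : 'I_m.+1 -> K) p : unshear_coef c p = unshear c p%:P.
Proof. by rewrite unshear_polyC. Qed.

Lemma unshear_coefC m (c : 'I_m.+1 -> K) a : unshear_coef c a%:MP = a%:MP.
Proof. by rewrite unshear_coefE unshearC. Qed.

Lemma ideal_gen_scale m (a : K) (p : {mpoly K[m]}) s : a != 0 ->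
  ideal_gen (a%:MP * p :: s) = ideal_gen (p :: s).
Proof.
move=> a0; apply/seteqP; split=> x /ideal_gen_consP[u [y sy ->]];
  apply/ideal_gen_consP.
  by exists (u * a%:MP), y; rewrite ?mulrA.
exists (u * (a^-1)%:MP), y => //.
by rewrite mulrA -[_ * a%:MP]mulrA -mpolyCM mulVf // mpolyC1 mulr1.
Qed.

(* R is a polynomial ring in one variable over K[x_0, .., x_(m-1)], in which  *)
(* a is monic. *)
Definition presentation m (R : idomainType) (iota : {rmorphism {mpoly K[m]} -> R})
    (a : R) : Prop :=
  exists (phi : {rmorphism R -> {poly {mpoly K[m]}}})
    (psi : {rmorphism {poly {mpoly K[m]}} -> R}),
  [/\ cancel phi psi, cancel psi phi, forall x, iota x = psi x%:P
    & phi a \is monic].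

Lemma presentationP m (a : {mpoly K[m.+1]}) : a != 0 ->
  exists al (iota : {rmorphism {mpoly K[m]} -> {mpoly K[m.+1]}}),
  [/\ al != 0, forall c, iota c%:MP = c%:MP & presentation iota (al%:MP * a)].
Proof.
move=> a0; have [c [al al0 [c0 am]]] := monic_coordinates a0.
exists al, (unshear_coef c); split=> //; first exact: unshear_coefC.
exists (shear c), (unshear c); split=> //; first exact: shearK.
  exact: unshearK.
exact: unshear_coefE.
Qed.

Lemma presentation_inj m (R : idomainType) (iota : {rmorphism {mpoly K[m]} -> R}) a :
  presentation iota a -> injective iota.
Proof. by case=> phi [psi [_ psiK iotaE _]]; exact: present_iota_inj psiK iotaE. Qed.

(** The ideal ((a) : x) meets a polynomial subring in one variable less outside 0, and R/(a) is
    torsion free over this subring. *)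
Lemma principal_unmixed m (a x : {mpoly K[m.+1]}) : a != 0 ->
  height_ge (quo (ideal_gen [:: a]) x) 2 -> ideal_gen [:: a] x.
Proof.
move=> a0; have [al [iota [al0 iotaC pres]]] := presentationP a0.
rewrite -(@ideal_gen_scale _ al) // => hx.
have [||e e0 ex] := @height_elimination _ _ _ 2 _ iota iotaC (presentation_inj pres) _ _ hx.
- by apply: quo_ideal; exact: ideal_gen_ideal.
- by [].
case: pres => phi [psi [phiK psiK iotaE am]].
by have := present_torsion_free phiK psiK iotaE am e0; apply.
Qed.

(** P meets the subring over which a is monic only in 0, for otherwise its height would be at least
    two. So only one generator is left. *)
Lemma principal_local m (P : set {mpoly K[m.+1]}) a : is_prime P ->
  ~ has_chain P 2 -> P a -> a != 0 -> exists G, locally_generated P [:: G].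
Proof.
move=> Pp nP Pa a0.
have [al [iota [al0 iotaC [phi [psi [phiK psiK iotaE am]]]]]] := presentationP a0.
have Pa' : P (al%:MP * a) by apply: ideal_mull => //; exact: prime_ideal.
have [|G PG] := present_locally_generated (s := [::]) phiK iotaE Pp am Pa'.
  have Pp' := preim_prime iota Pp.
  apply: locally_generated0 => //; apply: no_chain_zero => // ch.
  by apply: nP; have := present_chain phiK psiK iotaE Pp am Pa'; apply.
by exists G.
Qed.

Section TwoGenerators.
Variable m : nat.
Local Notation R := {mpoly K[m.+2]}.
Local Notation R' := {mpoly K[m.+1]}.
Local Notation R'' := {mpoly K[m]}.
Implicit Types (a b x u v : R) (P : set R).

(** A form of Noether normalization: a is monic over R' and N over R'', so that R/(a, b) is finite
    over R''. *)
Definition noether_position a b (iota : {rmorphism R' -> R})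
    (iota' : {rmorphism R'' -> R'}) (N : R') :=
  [/\ presentation iota a, presentation iota' N & ideal_gen [:: a; b] (iota N)].

Lemma noether_positionP a b : a != 0 -> height_ge (ideal_gen [:: a; b]) 2 ->
  exists al (iota : {rmorphism R' -> R}) (iota' : {rmorphism R'' -> R'}) N,
    [/\ al != 0, forall c, iota c%:MP = c%:MP,
    forall c, iota' c%:MP = c%:MP & noether_position (al%:MP * a) b iota iota' N].
Proof.
move=> a0 hab; have [al [iota [al0 iotaC pres]]] := presentationP a0.
have [||N N0 abN] := @height_elimination _ _ _ 2 _ iota iotaC (presentation_inj pres) _ _ hab.
- exact: ideal_gen_ideal.
- by [].
have [be [iota' [be0 iotaC' pres']]] := presentationP N0.
exists al, iota, iota', (be%:MP * N); split=> //; split=> //.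
rewrite ideal_gen_scale //.
have -> : iota (be%:MP * N) = be%:MP * iota N by rewrite rmorphM iotaC.
by apply: ideal_mull => //; exact: ideal_gen_ideal.
Qed.

Section Position.
Variables (a b : R) (iota : {rmorphism R' -> R}) (iota' : {rmorphism R'' -> R'}).
Variables (N : R') (e : R'').
Hypotheses (pos : noether_position a b iota iota' N) (e0 : e != 0).

Let N_regular y z : iota' e * y = N * z -> exists z', z = iota' e * z'.
Proof.
case: pos => _ [phi [psi [phiK psiK iotaE Nm]]] _; rewrite [RHS]mulrC.
by have := present_regular phiK psiK iotaE Nm; apply.
Qed.

Lemma noether_regular v x u : v * b = iota (iota' e) * x + u * a ->
  exists q r, v = q * a + iota (iota' e) * r.
Proof.
case: pos => -[phi [psi [phiK psiK iotaE am]]] _ abN.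
by have := present_regular2 phiK psiK iotaE am abN N_regular; apply.
Qed.

Lemma noether_torsion_free x :
  ideal_gen [:: a; b] (iota (iota' e) * x) -> ideal_gen [:: a; b] x.
Proof.
case: pos => -[phi [psi [phiK psiK iotaE am]]] pres' abN.
have := present_torsion_free2 phiK psiK iotaE am abN N_regular; apply.
by rewrite -(rmorph0 iota') (inj_eq (presentation_inj pres')).
Qed.

End Position.

Lemma noether_elimination a b (iota : {rmorphism R' -> R})
    (iota' : {rmorphism R'' -> R'}) N (I : set R) :
  (forall c, iota c%:MP = c%:MP) -> (forall c, iota' c%:MP = c%:MP) ->
  noether_position a b iota iota' N -> is_ideal I -> height_ge I 3 ->
  exists2 e, e != 0 & I (iota (iota' e)).
Proof.
move=> iotaC iotaC' [pres pres' _] hI ht.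
have C c : (iota \o iota') c%:MP = c%:MP by rewrite /= iotaC' iotaC.
have inj : injective (iota \o iota').
  by apply: inj_comp; [exact: presentation_inj pres|exact: presentation_inj pres'].
exact: (@height_elimination K m.+2 m 3 I (iota \o iota') C inj hI erefl ht).
Qed.

(* Macaulay's unmixedness theorem for two generators. *)
Lemma two_unmixed a b x : a != 0 -> height_ge (ideal_gen [:: a; b]) 2 ->
  height_ge (quo (ideal_gen [:: a; b]) x) 3 -> ideal_gen [:: a; b] x.
Proof.
move=> a0 hab hx.
have [al [iota [iota' [N [al0 iotaC iotaC' pos]]]]] := noether_positionP a0 hab.
have [|e e0] := noether_elimination iotaC iotaC' pos _ hx.
  by apply: quo_ideal; exact: ideal_gen_ideal.
rewrite /quo /= -(@ideal_gen_scale _ al) //.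
by have := noether_torsion_free pos e0; apply.
Qed.

(** Passing from R'' to R' by means of N, then to R by means of a, raises the height by at least one
    each time and adds one generator. As P has height at most two, it meets R'' only in 0. *)
Lemma two_local P a b : is_prime P -> ~ has_chain P 3 -> a != 0 -> P a -> P b ->
  height_ge (ideal_gen [:: a; b]) 2 ->
  exists G1 G2, locally_generated P [:: G1; G2].
Proof.
move=> Pp nP a0 Pa Pb hab.
have [al [iota [iota' [N [al0 iotaC iotaC' pos]]]]] := noether_positionP a0 hab.
have [[phi [psi [phiK psiK iotaE am]]] [phi' [psi' [phiK' psiK' iotaE' Nm]]] abN] := pos.
have hP := prime_ideal Pp.
have Pa' : P (al%:MP * a) by exact: ideal_mull.
have PN : (iota @^-1` P) N.
  move: abN => /ideal_gen2P[u [v]]; rewrite /= => ->.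
  by apply: ideal_add => //; exact: ideal_mull.
have Pp' := preim_prime iota Pp.
have [|G2 PG2] := present_locally_generated (s := [::]) phiK' iotaE' Pp' Nm PN.
  apply: locally_generated0; first exact: preim_prime.
  apply: no_chain_zero => [|ch]; first exact: preim_prime.
  apply: nP; have := present_chain phiK psiK iotaE Pp am Pa'; apply.
  by have := present_chain phiK' psiK' iotaE' Pp' Nm PN; apply.
have [G1 PG1] := present_locally_generated phiK iotaE Pp am Pa' PG2.
by exists G1, (iota G2).
Qed.

End TwoGenerators.

End Unmixedness.

(** * The Nullstellensatz *)

Section LyingOver.
Variables (A : comNzRingType) (K : closedFieldType) (ev : {rmorphism A -> K}).
Variables (J : set {poly A}) (g : {poly A}).
Hypotheses (hJ : is_ideal J) (gm : g \is monic) (Jg : J g).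
Hypothesis evJ : forall a, J a%:P -> ev a = 0.

(* Determinant trick: if q in J specializes to 1, then modulo J the powers of *)
(* z satisfy (1 - C) Z = 0 with ev C = 0, whence det (1 - C) lies in J. *)
Lemma lying_over q : J q -> map_poly ev q != 1.
Proof.
move=> Jq; apply/eqP => q1; case sg : (size g) => [|d].
  by move/eqP: sg; rewrite size_poly_eq0 (negPf (monic_neq0 gm)).
pose p i : {poly A} := 'X^i * (1 - q).
pose r i := Pdiv.Ring.rmodp (p i) g; pose h i := Pdiv.Ring.rdivp (p i) g.
have pE i : p i = h i * g + r i by exact: Pdiv.RingMonic.rdivp_eq.
have sr i : (size (r i) < size g)%N by exact: Pdiv.Ring.ltn_rmodpN0 (monic_neq0 gm).
have rJ i : J ('X^i - r i).
  have -> : 'X^i - r i = 'X^i * q + h i * g.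
    by rewrite -[r i](addKr (h i * g)) -pE /p; ring.
  by apply: ideal_add => //; exact: ideal_mull.
have evr i : map_poly ev (r i) = 0.
  have gm' : map_poly ev g \is monic by exact: monic_map.
  have rE : map_poly ev (r i) = - map_poly ev (h i) * map_poly ev g.
    have -> : r i = p i - h i * g by rewrite pE addrC addKr.
    by rewrite rmorphB !rmorphM rmorphB /= q1 rmorph1 subrr mulr0 add0r mulNr.
  have : (size (- map_poly ev (h i) * map_poly ev g)%R < size (map_poly ev g))%N.
    rewrite -rE; apply: leq_ltn_trans (size_poly _ _) _.
    by rewrite size_map_poly_id0 // (monicP gm) rmorph1 oner_eq0.
  by move/(monic_mul_small gm'); rewrite rE => ->; rewrite mul0r.
case: d sg => [|d] sg.
  have g1 : g = 1.
    rewrite (size1_polyC (eq_leq sg)); have := gm.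
    by rewrite monicE lead_coefE sg => /eqP ->.
  have := @evJ 1; rewrite -[1%:P]g1 => /(_ Jg) /eqP.
  by rewrite rmorph1 oner_eq0.
pose M : 'M[A]_d.+1 := 1%:M - \matrix_(i, j) (r i)`_j.
pose Z : 'cV[{poly A}]_d.+1 := \col_i 'X^i.
have MZ i : J ((map_mx polyC M *m Z) i 0).
  rewrite mxE; suff -> : \sum_j map_mx polyC M i j * Z j 0 = 'X^i - r i by [].
  under eq_bigr do rewrite !mxE rmorphB /= mulrBl.
  rewrite sumrB; congr (_ - _).
    rewrite (bigD1 i) //= eqxx mul1r big1 ?addr0 // => j ji.
    by rewrite eq_sym (negPf ji) mul0r.
  rewrite -[RHS]coefK poly_def; under [LHS]eq_bigr do rewrite mul_polyC.
  have sri : (size (r i) <= d.+1)%N by rewrite -ltnS -sg.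
  rewrite (big_ord_widen _ (fun j => (r i)`_j *: 'X^j) sri) [RHS]big_mkcond /=.
  apply: eq_bigr => j _; case: ltnP => // rj.
  by rewrite nth_default // scale0r.
(* Multiply M Z by the adjugate of M; the first entry of Z is z^0 = 1. *)
have Jdet : J (\det M)%:P.
  have : J ((\adj (map_mx polyC M) *m (map_mx polyC M *m Z)) 0 0).
    by rewrite mxE; apply: ideal_sum => // j _; exact: ideal_mull.
  by rewrite mulmxA mul_adj_mx mul_scalar_mx !mxE expr0 mulr1 det_map_mx.
have := evJ Jdet; rewrite -det_map_mx.
suff -> : map_mx ev M = 1%:M by rewrite det1 => /eqP; rewrite oner_eq0.
apply/matrixP => i j; rewrite !mxE rmorphB rmorph_nat.
by have /polyP/(_ j) := evr i; rewrite coef_map coef0 => ->; rewrite subr0.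
Qed.

(** The image of J in K[z] is a principal ideal, proper by [lying_over], and its generator therefore
    has a root. *)
Lemma common_root (lift : K -> A) : cancel lift ev ->
  exists x, forall q, J q -> (map_poly ev q).[x] = 0.
Proof.
move=> liftK; pose good k := exists q, [/\ J q, map_poly ev q != 0 & size (map_poly ev q) = k].
have [|k /asboolP[q [Jq q0 sq]] kmin] := @ex_minnP (fun k => `[< good k >]).
  exists (size (map_poly ev g)); apply/asboolP; exists g; split=> //.
  by apply: monic_neq0; exact: monic_map.
have lift_poly u : exists u', map_poly ev u' = u.
  exists (\poly_(i < size u) lift u`_i); apply/polyP => i.
  rewrite coef_map coef_poly; case: ltnP => [_|su]; first exact: liftK.
  by apply: etrans (rmorph0 ev) _; rewrite nth_default.
have dvd p : J p -> map_poly ev q %| map_poly ev p.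
  move=> Jp; rewrite /dvdp; apply: contrapT => /negP r0.
  have [h hE] := lift_poly (map_poly ev p %/ map_poly ev q).
  have rE : map_poly ev (p - h * q) = map_poly ev p %% map_poly ev q.
    by rewrite rmorphB rmorphM /= hE {1}(divp_eq (map_poly ev p) (map_poly ev q)) addrC addKr.
  have : (k <= size (map_poly ev p %% map_poly ev q)%R)%N.
    apply: kmin; apply/asboolP; exists (p - h * q); rewrite rE; split=> //.
    by apply: ideal_sub => //; exact: ideal_mull.
  by rewrite -sq leqNgt ltn_modp q0.
have sq1 : size (map_poly ev q) != 1%N.
  apply/negP => /size_poly1P[c c0 qc].
  have /eqP[] := @lying_over ((lift c^-1)%:P * q) (ideal_mull _ hJ Jq).
  by rewrite rmorphM /= map_polyC /= liftK qc -polyCM mulVf.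
have /closed_rootP[x qx] := sq1.
exists x => p /dvd /dvdpP[u ->].
by rewrite hornerM (rootP qx) mulr0.
Qed.

End LyingOver.

(** In suitable coordinates J contains a polynomial monic in the last one. By induction the elements
    of J free of this variable have a common zero, which [common_root] lifts. *)
Theorem weak_nullstellensatz (K : closedFieldType) m (J : set {mpoly K[m]}) :
  is_ideal J -> ~ J 1 -> exists v, forall p, J p -> p.@[v] = 0.
Proof.
elim: m J => [|m IHm] J hJ J1.
  exists (fun=> 0) => p Jp.
  have pE : p = (p@_0)%:MP.
    apply/mpolyP => mm; rewrite mcoeffC.
    have -> : mm = 0%MM; first by apply/mnmP => -[].
    by rewrite eqxx mulr1.
  rewrite pE mevalC; apply: contrapT => /eqP c0; apply: J1.
  have -> : 1 = (p@_0)^-1%:MP * p by rewrite {2}pE -mpolyCM mulVf // mpolyC1.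
  exact: ideal_mull.
have [[p [Jp p0]]|noP] := pselect (exists p, J p /\ p != 0); last first.
  exists (fun=> 0) => p Jp; have [->|p0] := eqVneq p 0; first exact: meval0.
  by case: noP; exists p.
have [c [al al0 [c0 gm]]] := monic_coordinates p0.
pose J' : set {poly {mpoly K[m]}} := unshear c @^-1` J.
have hJ' : is_ideal J' by exact: preim_ideal.
have J'g : J' (shear c (al%:MP * p)).
  by rewrite /J' /= (shearK c0); exact: ideal_mull.
pose J'' : set {mpoly K[m]} := polyC @^-1` J'.
have hJ'' : is_ideal J'' by exact: (@preim_ideal _ _ polyC).
have [|v vP] := IHm J'' hJ''.
  by rewrite /J'' /= /J' /= polyC1 rmorph1.
have [x xP] := @common_root _ _ (meval v) J' _ hJ' gm J'g vP
  (@mpolyC m K) (@mevalC _ _ v).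
have [w wP] := shear_point c v x.
exists w => q Jq; rewrite -wP; apply: xP.
by rewrite /J' /= (shearK c0).
Qed.

(** * Forms and smooth pairs *)

Section Homogeneous.
Variables (K : fieldType) (m : nat).
Implicit Types (p q b : {mpoly K[m]}) (I : set {mpoly K[m]}).

Lemma pihomogM d b e p : b \is d.-homog ->
  pihomog mdeg e (b * p) = if (d <= e)%N then b * pihomog mdeg (e - d) p else 0.
Proof.
move=> bd; pose k := (msize p + e).+1.
have pE : b * p = \sum_(j < k) b * pihomog mdeg j p.
  rewrite -mulr_sumr -pihomog_partitionE // /k; exact: leqW (leq_addr _ _).
have {pE} -> : pihomog mdeg e (b * p) =
    \sum_(j < k) pihomog mdeg e (b * pihomog mdeg j p).
  by rewrite pE raddf_sum.
have homM (j : nat) : b * pihomog mdeg j p \is (d + j).-homog.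
  by apply: dhomogM => //; exact: pihomogP.
case: leqP => [lde|led].
  have ltk : (e - d < k)%N by rewrite ltnS (leq_trans (leq_subr _ _)) ?leq_addl.
  rewrite (bigD1 (Ordinal ltk)) //= big1 ?addr0.
    by rewrite pihomog_dE //; have := homM (e - d)%N; rewrite subnKC //.
  move=> j; rewrite -val_eqE /= => je.
  by apply: (@pihomog_ne0 _ _ _ (d + j)%N); [lia|exact: homM].
apply: big1 => j _; apply: (@pihomog_ne0 _ _ _ (d + j)%N); last exact: homM.
by lia.
Qed.

Lemma pihomog_sumE p : p = \sum_(d < msize p) pihomog mdeg d p.
Proof. exact: pihomog_partitionE. Qed.

Lemma ideal_gen_homogeneous (s : seq {mpoly K[m]}) :
  (forall p, p \in s -> exists d, p \is d.-homog) ->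
  homogeneous_ideal (ideal_gen s).
Proof.
move=> hs; split; first exact: ideal_gen_ideal.
move=> F d [c ->]; rewrite raddf_sum /=.
apply: ideal_sum => [|i _]; first exact: ideal_gen_ideal.
have si : s`_i \in s by exact: mem_nth.
have [e se] := hs _ si; rewrite mulrC (pihomogM _ _ se).
case: ifP => _; last by apply: ideal_zero; exact: ideal_gen_ideal.
by apply: ideal_mulr; [exact: ideal_gen_ideal|exact: ideal_gen_mem].
Qed.

Lemma dhomog_mderiv p d i : p \is d.-homog -> p^`M(i) \is (d.-1).-homog.
Proof.
move=> /dhomogP pd; apply/dhomogP => mm; rewrite mcoeff_msupp mcoeff_deriv => pm.
have : (mm + U_(i))%MM \in msupp p.
  by rewrite mcoeff_msupp; apply: contraNneq pm => ->; rewrite mul0rn.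
by move=> /pd /= <-; rewrite mdegD mdeg1 addn1.
Qed.

Lemma euler p d : p \is d.-homog -> \sum_i 'X_i * p^`M(i) = p *+ d.
Proof.
move=> /dhomogP pd.
transitivity (\sum_(mm <- msupp p) p@_mm *: \sum_i 'X_i * ('X_[mm] : {mpoly K[m]})^`M(i)).
  rewrite [LHS](eq_bigr (fun i => \sum_(mm <- msupp p)
      p@_mm *: ('X_i * ('X_[mm] : {mpoly K[m]})^`M(i)))).
    by rewrite exchange_big /=; apply: eq_bigr => mm _; rewrite scaler_sumr.
  move=> i _; rewrite {1}(mpolyE p) raddf_sum mulr_sumr /=.
  by apply: eq_bigr => mm _; rewrite linearZ /= scalerAr.
rewrite [in RHS](mpolyE p) -sumrMnl !big_seq.
apply: eq_bigr => mm mmp; rewrite scalerMnr; congr (_ *: _).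
rewrite -(pd _ mmp) /= mdegE -sumrMnr; apply: eq_bigr => i _.
rewrite mderivX -scalerAr -mpolyXD.
have [mi0|mi0] := posnP (mm i); first by rewrite mi0 scale0r mulr0n.
rewrite addmC submK ?scaler_nat // .
by apply/mnm_lepP => j; rewrite mnm1E; case: eqP => // <-.
Qed.

End Homogeneous.

Lemma jacobian_ideal_mem (K : fieldType) m (p : {mpoly K[m]}) i :
  jacobian_ideal p p^`M(i).
Proof. by apply: ideal_gen_mem; apply: map_f; rewrite mem_enum. Qed.

Lemma jacobian_ideal_ideal (K : fieldType) m (p : {mpoly K[m]}) :
  is_ideal (jacobian_ideal p).
Proof. exact: ideal_gen_ideal. Qed.

Lemma jacobian_ideal_sub (K : fieldType) m (p : {mpoly K[m]}) I :
  is_ideal I -> (forall i, I p^`M(i)) -> jacobian_ideal p `<=` I.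
Proof. by move=> hI Ip; apply: ideal_gen_sub => // x /mapP[i _ ->]. Qed.

Lemma jacobian_ideal_homogeneous (K : fieldType) m (p : {mpoly K[m]}) d :
  p \is d.-homog -> homogeneous_ideal (jacobian_ideal p).
Proof.
move=> pd; apply: ideal_gen_homogeneous => x /mapP[i _ ->].
by exists d.-1; exact: dhomog_mderiv.
Qed.

(** Euler's relation, the degree being invertible in characteristic zero. *)
Lemma jacobian_ideal_self (K : fieldType) m (p : {mpoly K[m]}) d :
  [pchar K] =i pred0 -> (0 < d)%N -> p \is d.-homog -> jacobian_ideal p p.
Proof.
move=> K0 d0 pd; have dn0 : (d%:R : K) != 0 by rewrite (GRing.pcharf0P K).1 // -lt0n.
suff : jacobian_ideal p ((d%:R^-1 : K) *: \sum_i 'X_i * p^`M(i)).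
  by rewrite (euler pd) -scaler_nat scalerA mulVf // scale1r.
rewrite -mul_mpolyC; apply: ideal_mull; first exact: jacobian_ideal_ideal.
apply: ideal_sum => [|i _]; first exact: jacobian_ideal_ideal.
by apply: ideal_mull; [exact: jacobian_ideal_ideal|exact: jacobian_ideal_mem].
Qed.

Section HomogeneousZeros.
Variables (K : closedFieldType) (m : nat).

(* In the graded ring R/J, 1 = (1 - x_i) u forces u_d = x_i^d for every d, so *)
(* that x_i is nilpotent. *)
Lemma homogeneous_zero (J : set {mpoly K[m]}) (i : 'I_m) : homogeneous_ideal J ->
  (forall k, ~ J ('X_i ^+ k)) ->
  exists v, v i != 0 /\ forall p, J p -> p.@[v] = 0.
Proof.
move=> [hJ homJ] JX.
pose J1 : set {mpoly K[m]} := [set p | exists q u, J q /\ p = q + (1 - 'X_i) * u].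
have hJ1 : is_ideal J1.
  split; first by exists 0, 0; split; [exact: ideal_zero|rewrite mulr0 addr0].
    move=> _ _ [q [u [Jq ->]]] [q' [u' [Jq' ->]]].
    by exists (q + q'), (u + u'); split; [exact: ideal_add|rewrite mulrDr addrACA].
  move=> a _ [q [u [Jq ->]]]; exists (a * q), (a * u); split; first exact: ideal_mull.
  by rewrite mulrDr mulrCA.
have [|v vP] := weak_nullstellensatz hJ1; last first.
  exists v; split.
    have : ((1 - 'X_i) : {mpoly K[m]}).@[v] = 0.
      apply: vP; exists 0, 1; rewrite mulr1 add0r; split=> //; exact: ideal_zero.
    rewrite mevalB meval1 mevalXU => /eqP; rewrite subr_eq0 => /eqP <-.
    exact: oner_neq0.
  by move=> p Jp; apply: vP; exists p, 0; rewrite mulr0 addr0.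
move=> [q [u [Jq E]]].
have {}E : u = 1 - q + 'X_i * u by rewrite E; ring.
have Xi : ('X_i : {mpoly K[m]}) \is 1.-homog by rewrite dhomogX /= mdeg1.
have ud d : J (pihomog mdeg d u - 'X_i ^+ d).
  elim: d => [|d IHd]; rewrite E raddfD raddfB /= (pihomogM _ _ Xi) /=.
    rewrite addr0 expr0 (pihomog_dE (dhomog1 _ _)) addrAC subrr add0r.
    by apply: ideal_opp => //; exact: homJ.
  rewrite (pihomog_ne0 (d := 0%N)) ?dhomog1 // sub0r subn1 /= exprS.
  rewrite -addrA -mulrBr; apply: ideal_add => //; last exact: ideal_mull.
  by apply: ideal_opp => //; exact: homJ.
have := ud (msize u); have -> : pihomog mdeg (msize u) u = 0.
  apply/mpolyP => mm; rewrite mcoeff_pihomog mcoeff0; case: eqP => // mmu.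
  by apply: memN_msupp_eq0; apply: msize_mdeg_ge; rewrite mmu.
by rewrite sub0r => /(ideal_opp hJ); rewrite opprK; exact: JX.
Qed.

End HomogeneousZeros.

Section Origin.
Variables (K : fieldType) (m : nat).
Implicit Types P : set {mpoly K[m]}.

(** Its kernel is the ideal of the first k variables, which is prime as the preimage of 0 in a
    domain. *)
Definition kill_vars k : {mpoly K[m]} -> {mpoly K[m]} :=
  mmap (@mpolyC m K) (fun i : 'I_m => if (i < k)%N then 0 else 'X_i).

HB.instance Definition _ k := GRing.RMorphism.on (kill_vars k).

Lemma kill_varsC k c : kill_vars k c%:MP = c%:MP.
Proof. by rewrite /kill_vars mmapC. Qed.

Lemma kill_varsX k i : kill_vars k 'X_i = if (i < k)%N then 0 else 'X_i.
Proof. by rewrite /kill_vars mmapX mmap1U. Qed.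

Lemma kill_vars_prime k : is_prime (kill_vars k @^-1` [set 0]).
Proof. exact: preim_prime (zero_prime _). Qed.

Lemma kill_varsS k p : kill_vars k.+1 (kill_vars k p) = kill_vars k.+1 p.
Proof.
apply: (@mpoly_morph_ext _ _ _ (kill_vars k.+1 \o kill_vars k) (kill_vars k.+1)).
  by move=> c /=; rewrite !kill_varsC.
move=> i /=; rewrite kill_varsX; case: ifP => // ik.
by rewrite rmorph0 kill_varsX ltnS (ltnW ik).
Qed.

Lemma prime_origin P p : is_prime P -> (forall i, P 'X_i) -> P (p - (p@_0)%:MP).
Proof.
move=> Pp PX; have hP := prime_ideal Pp.
suff PE : P (p - \sum_(mm <- msupp p) (if mm == 0%MM then (p@_mm)%:MP else 0)).
  suff <- : \sum_(mm <- msupp p) (if mm == 0%MM then (p@_mm)%:MP else 0)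
    = (p@_0)%:MP_[m] by [].
  have [p0|p0] := boolP (0%MM \in msupp p).
    rewrite (bigD1_seq 0%MM) ?msupp_uniq //= eqxx big1 ?addr0 //.
    by move=> mm /negPf ->.
  rewrite (memN_msupp_eq0 p0) mpolyC0 big1_seq // => mm /andP[_ mmp].
  by case: eqP => // mm0; rewrite -mm0 mmp in p0.
rewrite [p in p - _](mpolyE p) -sumrB; apply: ideal_sum => // mm _.
have [->|mm0] := eqVneq mm 0%MM.
  rewrite -mul_mpolyC mpolyX0 mulr1 subrr; exact: ideal_zero.
rewrite subr0 -mul_mpolyC; apply: ideal_mull => //.
have [i mi] : exists i, (0 < mm i)%N.
  apply: contrapT => nomi; move/eqP: mm0; apply; apply/mnmP => i; rewrite mnm0E.
  by apply/eqP; rewrite -leqn0 leqNgt; apply/negP => mi; apply: nomi; exists i.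
have <- : (mm - U_(i) + U_(i))%MM = mm.
  by rewrite submK //; apply/mnm_lepP => j; rewrite mnm1E; case: eqP => // <-.
by rewrite mpolyXD; apply: ideal_mull.
Qed.

Lemma kill_vars_sub P k : is_prime P -> (forall i, P 'X_i) ->
  kill_vars k @^-1` [set 0] `<=` P.
Proof.
move=> Pp PX p /= kp; have hP := prime_ideal Pp.
pose ev0 : {rmorphism {mpoly K[m]} -> K} := mcoeff 0%MM.
have p0 : p@_0 = 0.
  have <- : (kill_vars k p)@_0 = p@_0; last by rewrite kp mcoeff0.
  apply: (@mpoly_morph_ext _ _ _ (ev0 \o kill_vars k) ev0) => [c|i] /=.
    by rewrite kill_varsC.
  rewrite kill_varsX; case: ifP => // _; rewrite mcoeff0 mcoeffX.
  by case: eqP => // /mnmP/(_ i); rewrite mnm1E eqxx mnm0E.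
by have := prime_origin p Pp PX; rewrite p0 mpolyC0 subr0.
Qed.

(** The kernels of the [kill_vars k] form a chain below P. Hence, in at least three variables, a
    prime of height at most two misses some variable. *)
Lemma origin_chain P h : (h <= m)%N -> is_prime P -> (forall i, P 'X_i) ->
  has_chain P h.
Proof.
move=> hm Pp PX; pose C k : set {mpoly K[m]} := kill_vars k @^-1` [set 0].
have ch k : (k <= m)%N -> has_chain (C k) k.
  elim: k => [_|k IHk km]; first by apply: has_chain0; exact: kill_vars_prime.
  apply: has_chain_cons (IHk (ltnW km)) _ _; last exact: kill_vars_prime.
  split; first by move=> p; rewrite /C /= => kp; rewrite -kill_varsS kp rmorph0.
  move=> /(_ 'X_(Ordinal km)); rewrite /C /= !kill_varsX /= ltnSn ltnn => H.
  by have /eqP := H erefl; rewrite -msize_poly_eq0 msizeX.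
by apply: (has_chain_sub (ch h hm)) => //; exact: kill_vars_sub.
Qed.

End Origin.

(** The vectors (A 1 k, - A 0 k) lie in the left kernel. Were it trivial, row 0 would vanish, and
    (1, 0) would lie in it. *)
Lemma rank2_minors (K : fieldType) m (A : 'M[K]_(2, m)) :
  (forall k l, A 0 k * A 1 l = A 0 l * A 1 k) -> \rank A != 2.
Proof.
move=> A01; apply/negP => rA.
have Afree : row_free A by exact: rA.
have ker (u : 'rV[K]_2) : (forall l, u 0 0 * A 0 l + u 0 1 * A 1 l = 0) -> u = 0.
  move=> uA; apply/eqP; rewrite -(mulmx_free_eq0 _ Afree); apply/eqP.
  apply/rowP => l; rewrite mxE [RHS]mxE; apply: etrans (uA l).
  rewrite !big_ord_recl big_ord0 addr0.
  by congr (_ + u 0 _ * A _ l); exact: val_inj.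
have A0 k : A 0 k = 0.
  have : \row_(i < 2) (if i == 0 then A 1 k else - A 0 k) = 0.
    by apply: ker => l; rewrite !mxE /= mulNr (A01 k l) mulrC subrr.
  by move/rowP/(_ 1); rewrite !mxE /= => /eqP; rewrite oppr_eq0 => /eqP.
have : \row_(i < 2) (if i == 0 then 1 else 0) = 0 :> 'rV[K]_2.
  by apply: ker => l; rewrite !mxE /= A0 mulr0 mul0r addr0.
by move/rowP/(_ 0); rewrite !mxE /= => /eqP; rewrite oner_eq0.
Qed.

Definition minor (K : fieldType) m (a b : {mpoly K[m]}) (k l : 'I_m) :=
  a^`M(k) * b^`M(l) - a^`M(l) * b^`M(k).

Section SmoothPairs.
Variables (K : closedFieldType) (m : nat).
Hypothesis m_ge3 : (3 <= m)%N.
Variables (a b : {mpoly K[m]}) (da db : nat).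
Hypotheses (ahom : a \is da.-homog) (bhom : b \is db.-homog).
Hypothesis smooth : smooth_intersection [:: a; b].
Implicit Types P : set {mpoly K[m]}.

Lemma smooth_height : height_ge (ideal_gen [:: a; b]) 2.
Proof. by case: smooth => -[]. Qed.

(** Otherwise P contains the homogeneous ideal of a, b and all minors. As P misses some variable,
    this ideal has a zero in projective space, where the two gradients would be dependent. *)
Lemma smooth_minor P : is_prime P -> ~ has_chain P 3 -> P a -> P b ->
  exists k l, ~ P (minor a b k l).
Proof.
move=> Pp nP Pa Pb; apply: contrapT => Pminor.
have {}Pminor k l : P (minor a b k l).
  by apply: contrapT => nM; apply: Pminor; exists k, l.
pose ms := [seq minor a b kl.1 kl.2 | kl <- enum {: 'I_m * 'I_m}].
pose J := ideal_gen (a :: b :: ms).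
have JP : J `<=` P.
  apply: ideal_gen_sub; first exact: prime_ideal.
  move=> x; rewrite !inE => /predU1P[-> //|/predU1P[-> //|/mapP[kl _ ->]]].
  exact: Pminor.
have homJ : homogeneous_ideal J.
  apply: ideal_gen_homogeneous => x.
  rewrite !inE => /predU1P[->|/predU1P[->|/mapP[kl _ ->]]].
  - by exists da.
  - by exists db.
  - exists (da.-1 + db.-1)%N; rewrite /minor rpredB //;
      by apply: dhomogM; exact: dhomog_mderiv.
have [i PXi] : exists i, ~ P 'X_i.
  apply: contrapT => PX; apply: nP; apply: origin_chain => // i.
  by apply: contrapT => PXi; apply: PX; exists i.
have [|v [vi vP]] := homogeneous_zero (i := i) homJ.
  by move=> k /JP /(primeX Pp).
have [_ /(_ v (ex_intro _ i vi)) rk] := smooth.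
have /rk /eqP : forall F, F \in [:: a; b] -> F.@[v] = 0.
  move=> F; rewrite !inE => /orP[] /eqP ->; apply: vP; apply: ideal_gen_mem;
    by rewrite !inE eqxx ?orbT.
apply/negP; apply: rank2_minors => k l; rewrite !mxE /=.
have : (minor a b k l).@[v] = 0.
  apply: vP; apply: ideal_gen_mem; rewrite !inE; apply/orP; right; apply/orP; right.
  by apply/mapP; exists (k, l); rewrite ?mem_enum.
by rewrite mevalB !mevalM => /eqP; rewrite subr_eq0 => /eqP.
Qed.

End SmoothPairs.

(* The minors of (a, b) and of (G1, G2) differ modulo P by the determinant of *)
(* the transition matrix, which is therefore outside P as soon as one minor   *)
(* of (a, b) is. *)
Lemma local_generators_minor (K : fieldType) m (P : set {mpoly K[m]})
    (a b G1 G2 e e' al be ga de : {mpoly K[m]}) k l :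
  is_prime P -> P a -> P b -> P G1 -> P G2 -> ~ P e -> ~ P e' ->
  e * a = al * G1 + be * G2 -> e' * b = ga * G1 + de * G2 ->
  ~ P (minor a b k l) -> ~ P (al * de - be * ga).
Proof.
move=> Pp Pa Pb PG1 PG2 Pe Pe' aE bE Pm PD; have hP := prime_ideal Pp.
have deriv i (u x v y w z : {mpoly K[m]}) : P x -> P y -> P z ->
    u * x = v * y + w * z ->
    exists2 t, P t & u * x^`M(i) = v * y^`M(i) + w * z^`M(i) + t.
  move=> Px Py Pz /(congr1 (mderiv i)); rewrite mderivD !mderivM => E.
  exists (v^`M(i) * y + w^`M(i) * z - u^`M(i) * x).
    by apply: ideal_sub => //; [apply: ideal_add => //|]; exact: ideal_mull.
  by rewrite -[LHS](addKr (u^`M(i) * x)) E; ring.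
have [t Pt tE] := deriv k _ _ _ _ _ _ Pa PG1 PG2 aE.
have [t' Pt' tE'] := deriv l _ _ _ _ _ _ Pa PG1 PG2 aE.
have [r Pr rE] := deriv k _ _ _ _ _ _ Pb PG1 PG2 bE.
have [r' Pr' rE'] := deriv l _ _ _ _ _ _ Pb PG1 PG2 bE.
have : P (e * e' * minor a b k l).
  have -> : e * e' * minor a b k l = (e * a^`M(k)) * (e' * b^`M(l))
      - (e * a^`M(l)) * (e' * b^`M(k)) by rewrite /minor; ring.
  rewrite tE tE' rE rE'.
  set x := G1^`M(k); set y := G2^`M(k); set z := G1^`M(l); set w := G2^`M(l).
  have -> : (al * x + be * y + t) * (ga * z + de * w + r') -
      (al * z + be * w + t') * (ga * x + de * y + r) =
      (x * w - z * y) * (al * de - be * ga) + ((al * x + be * y) * r'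
        + (ga * z + de * w + r') * t - (al * z + be * w) * r - (ga * x + de * y + r) * t').
    by ring.
  apply: ideal_add; [by []|exact: ideal_mull|].
  do 3! [apply: ideal_sub || apply: ideal_add; [by []| |exact: ideal_mull]].
  exact: ideal_mull.
by move=> /(primeM Pp)[/(primeM Pp)[]|].
Qed.

Section SmoothLocal.
Variables (K : closedFieldType) (m : nat).
Hypothesis m_gt0 : (0 < m)%N.
Variables (a b : {mpoly K[m.+2]}) (da db : nat).
Hypotheses (a_neq0 : a != 0) (ahom : a \is da.-homog) (bhom : b \is db.-homog).
Hypothesis smooth : smooth_intersection [:: a; b].
Implicit Types P : set {mpoly K[m.+2]}.

(* By Cramer's rule, (a, b) generates the maximal ideal of R_P. *)
Lemma smooth_local P x : is_prime P -> ~ has_chain P 3 -> P a -> P b -> P x ->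
  exists u, ~ P u /\ ideal_gen [:: a; b] (u * x).
Proof.
move=> Pp nP Pa Pb Px; have hP := prime_ideal Pp.
have [k [l Pkl]] := smooth_minor (m_gt0 : (3 <= m.+2)%N) ahom bhom smooth Pp nP Pa Pb.
have [G1 [G2 [PG gen]]] := two_local Pp nP a_neq0 Pa Pb (smooth_height smooth).
have PG1 : P G1 by apply: PG; rewrite inE eqxx.
have PG2 : P G2 by apply: PG; rewrite !inE eqxx orbT.
have [e [Pe /ideal_gen2P[al [be aE]]]] := gen _ Pa.
have [e' [Pe' /ideal_gen2P[ga [de bE]]]] := gen _ Pb.
have [e'' [Pe'' /ideal_gen2P[xi [eta xE]]]] := gen _ Px.
have PD := local_generators_minor Pp Pa Pb PG1 PG2 Pe Pe' aE bE Pkl.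
exists ((al * de - be * ga) * e''); split; first exact: primeMN.
apply/ideal_gen2P; exists (xi * de * e - eta * ga * e), (eta * al * e' - xi * be * e').
rewrite -[LHS]mulrA xE.
have -> : (xi * de * e - eta * ga * e) * a + (eta * al * e' - xi * be * e') * b
  = (xi * de - eta * ga) * (e * a) + (eta * al - xi * be) * (e' * b) by ring.
by rewrite aE bE; ring.
Qed.

(** The ideal ((a) : y) contains (a, b), so it has height at least two, and (a) is unmixed. *)
Lemma smooth_regular y : ideal_gen [:: a] (b * y) -> ideal_gen [:: a] y.
Proof.
move=> /ideal_gen1P[u by_]; apply: principal_unmixed => //.
apply: height_geS (smooth_height smooth) => z /ideal_gen2P[v [w ->]].
apply/ideal_gen1P; exists (v * y + w * u).
by rewrite !mulrDl -[w * b * y]mulrA by_; ring.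
Qed.

End SmoothLocal.

(** * Height of the Jacobian ideal *)

Section JacobianHeight.
Variables (K : closedFieldType) (m : nat).
Hypothesis K0 : [pchar K] =i pred0.
Hypothesis m_gt0 : (0 < m)%N.
Variables (a b : {mpoly K[m.+2]}) (da db : nat).
Hypotheses (a_neq0 : a != 0) (ahom : a \is da.-homog) (bhom : b \is db.-homog).
Hypotheses (da_gt0 : (0 < da)%N) (db_gt0 : (0 < db)%N).
Hypothesis smooth : smooth_intersection [:: a; b].

Let gen_a_ideal : is_ideal (ideal_gen [:: a]). Proof. exact: ideal_gen_ideal. Qed.

Let gen_a_homog : homogeneous_ideal (ideal_gen [:: a]).
Proof. by apply: ideal_gen_homogeneous => x; rewrite inE => /eqP ->; exists da. Qed.

(* V(a) has no singular point on V(b), apart from the origin. *)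
Lemma jacobian_section_height :
  height_ge (ideal_gen (b :: [seq a^`M(i) | i <- enum 'I_m.+2])) 3.
Proof.
move=> P Pp JP; apply: contrapT => nP.
have Pb : P b by apply: JP; apply: ideal_gen_mem; rewrite inE eqxx.
have PJ : jacobian_ideal a `<=` P.
  by move=> x /(@ideal_gen_cons_sub _ b); exact: JP.
have Pa : P a by apply: PJ; exact: jacobian_ideal_self ahom.
have Pai i : P a^`M(i) by apply: PJ; exact: jacobian_ideal_mem.
have hP := prime_ideal Pp.
have [k [l]] := smooth_minor (m_gt0 : (3 <= m.+2)%N) ahom bhom smooth Pp nP Pa Pb.
by apply; apply: ideal_sub => //; exact: ideal_mulr.
Qed.

Let annihilator (w : {mpoly K[m.+2]}) := forall i, ideal_gen [:: a] (w * a^`M(i)).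

(* Modulo a, an annihilator of Jac(a) is b times another one: e w lies in     *)
(* (a, b) for some e <> 0 in K[x_0, .., x_(m-1)], and (a, b, e) is regular. *)
Lemma annihilator_descent w : annihilator w ->
  exists r u, w = b * r + u * a.
Proof.
move=> wa; have [al [iota [iota' [N [al0 iotaC iotaC' pos]]]]] :=
  noether_positionP a_neq0 (smooth_height smooth).
have [|e e0] := noether_elimination iotaC iotaC' pos _ jacobian_section_height.
  exact: ideal_gen_ideal.
(* Here e = q b + h with h in Jac(a), so h w lies in (a) and q w b is e w modulo a. Then q w is e r
   modulo a, and cancelling e gives w = b r modulo a. *)
case/ideal_gen_consP => q [h Jh eE].
have [c hw] : exists c, h * w = c * a.
  apply/ideal_gen1P; have := Jh; rewrite -/(jacobian_ideal a).
  suff : jacobian_ideal a `<=` [set h | ideal_gen [:: a] (h * w)] by apply.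
  apply: jacobian_ideal_sub => [|i]; last by rewrite /= mulrC; exact: wa.
  exact: (@quo_ideal _ (ideal_gen [:: a]) w).
have bqw : (q * w) * b = iota (iota' e) * w + (- (al^-1)%:MP * c) * (al%:MP * a).
  have -> : - (al^-1)%:MP * c * (al%:MP * a) = - ((al^-1)%:MP * al%:MP) * (c * a) by ring.
  rewrite -mpolyCM mulVf // mpolyC1 -hw eE; ring.
have [q' [r qw]] := noether_regular pos bqw.
have [pres pres' _] := pos.
have e0' : iota' e != 0.
  by rewrite -(rmorph0 iota') (inj_eq (presentation_inj pres')).
case: pres => phi [psi [phiK psiK iotaE am]].
have tf := present_torsion_free phiK psiK iotaE am e0'.
have : ideal_gen [:: al%:MP * a] (iota (iota' e) * (w - b * r)).
  rewrite ideal_gen_scale //; apply/ideal_gen1P; exists (c + b * q' * al%:MP).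
  have -> : iota (iota' e) * (w - b * r) =
    iota (iota' e) * w - b * (iota (iota' e) * r) by ring.
  have -> : iota (iota' e) * r = q * w - q' * (al%:MP * a) by rewrite qw addrC addKr.
  have -> : iota (iota' e) * w = c * a + q * b * w by rewrite eE -hw; ring.
  by ring.
move=> /tf; rewrite ideal_gen_scale // => /ideal_gen1P[u wE].
by exists r, u; rewrite -wE; ring.
Qed.

Lemma annihilator_homogeneous w d : annihilator w -> annihilator (pihomog mdeg d w).
Proof.
move=> wa i; have [_ homa] := gen_a_homog.
have := homa _ (da.-1 + d)%N (wa i); rewrite mulrC.
by rewrite (pihomogM _ _ (dhomog_mderiv i ahom)) leq_addr addKn mulrC.
Qed.

(** Strong induction on the degree of a homogeneous w: the factor r of [annihilator_descent] is
    again an annihilator, because b is regular modulo a, and has smaller degree, because b has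
    positive degree. *)
Lemma annihilator_sub w : annihilator w -> ideal_gen [:: a] w.
Proof.
have [_ homa] := gen_a_homog.
have hom d : forall w', w' \is d.-homog -> annihilator w' -> ideal_gen [:: a] w'.
  elim/ltn_ind: d => d IHd w' wd wa; have [r [u wE]] := annihilator_descent wa.
  have {}wE : w' = pihomog mdeg d (b * r) + pihomog mdeg d (u * a).
    by rewrite -raddfD -wE /= pihomog_dE.
  have ua : ideal_gen [:: a] (pihomog mdeg d (u * a)).
    by apply: homa; apply/ideal_gen1P; exists u.
  rewrite wE; apply: ideal_add => //; move: wE; rewrite (pihomogM _ _ bhom).
  case: leqP => [dbd|_] wE; last exact: ideal_zero.
  apply: ideal_mull => //.
  apply: (IHd (d - db)%N); [by lia|exact: pihomogP|move=> i].
  apply: (smooth_regular a_neq0 smooth); rewrite mulrA.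
  have -> : b * pihomog mdeg (d - db) r = w' - pihomog mdeg d (u * a).
    by rewrite [w' in RHS]wE addrK.
  by rewrite mulrBl; apply: ideal_sub => //; exact: ideal_mulr.
move=> wa; rewrite (pihomog_sumE w); apply: ideal_sum => // d _.
by apply: (hom d); [exact: pihomogP|exact: annihilator_homogeneous].
Qed.

(* Otherwise R_P is a discrete valuation ring for some prime P containing     *)
(* Jac(a), and a/G annihilates Jac(a) for any generator G of P R_P. *)
Lemma jacobian_height : height_ge (jacobian_ideal a) 2.
Proof.
move=> P Pp JP; apply: contrapT => nP.
have Pa : P a by apply: JP; exact: jacobian_ideal_self ahom.
have [G [PG gen]] := principal_local Pp nP Pa a_neq0.
have [e [Pe /ideal_gen1P[al aE]]] := gen _ Pa.
have [|i|e' [Pe' eJ]] := @common_denominator _ P (ideal_gen [:: G]) _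
    (fun i => a^`M(i)) Pp.
- exact: ideal_gen_ideal.
- by apply: gen; apply: JP; exact: jacobian_ideal_mem.
have /ideal_gen1P[c cE] : ideal_gen [:: a] (al * e').
  apply: annihilator_sub => i; have /ideal_gen1P[u uE] := eJ i.
  apply/ideal_gen1P; exists (u * e).
  by rewrite -[LHS]mulrA uE -mulrA aE; ring.
have PGG : P G by apply: PG; rewrite inE.
have : P (e' * e).
  suff -> : e' * e = c * G by apply: ideal_mull => //; exact: prime_ideal.
  apply: (mulIf a_neq0); rewrite -mulrA aE mulrA [e' * al]mulrC cE; ring.
exact: primeMN.
Qed.

End JacobianHeight.

(** * Top dimensional parts *)

Section Top.
Variable R : comNzRingType.
Implicit Types (I J P Q T : set R) (x y : R).

Lemma primary_height Q h : is_primary Q -> height_ge Q h <-> has_chain (radical Q) h.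
Proof.
move=> Qp; split=> [hQ|hr P Pp QP].
  by apply: hQ; [exact: radical_prime|exact: radical_sub].
by apply: (has_chain_sub hr) => //; exact: radical_prime_sub.
Qed.

Lemma prime_height P h : is_prime P -> height_ge P h <-> has_chain P h.
Proof.
by move=> Pp; split=> [hP|hP Q Qp PQ]; [exact: hP|exact: has_chain_sub hP PQ Qp].
Qed.

(** At a prime P of height at most two, a component of height at least three becomes trivial, as its
    radical is not contained in P. Conversely, if P is the radical of a height two component Q_i,
    then u x in Q_i with u outside P forces x in Q_i. *)
Lemma is_topP I T : is_ideal I -> height_ge I 2 -> is_top I T ->
  forall x, T x <-> height_ge (quo I x) 3.
Proof.
move=> hI I2 [k [Q [[Qp IE _ _] ->]]] x.
have IQ i : I `<=` Q i by rewrite IE => y; apply.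
split=> [Tx|].
  apply/(height_ge_quoP _ _ hI) => P Pp nP.
  have /choice[u uP] : forall i, exists u, ~ P u /\ Q i (u * x).
    move=> i; have hQ := primary_ideal (Qp i).
    have [Q2|nQ2] := pselect (codim_eq (Q i) 2).
      by exists 1; rewrite mul1r; split; [exact: prime_neq1|exact: Tx].
    have Q3 : height_ge (Q i) 3.
      apply: contrapT => nQ3; apply: nQ2; split=> //; exact: height_geS I2.
    have [y [[l Qy] Py]] : exists y, radical (Q i) y /\ ~ P y.
      apply: contrapT => noy; apply: nP.
      apply: (has_chain_sub ((primary_height 3 (Qp i)).1 Q3)) => // y Qy.
      by apply: contrapT => Py; apply: noy; exists y.
    by exists (y ^+ l); split; [exact: primeXN|exact: ideal_mulr].
  exists (\prod_i u i); split; first by apply: prime_prodN => // i _; case: (uP i).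
  rewrite IE => i _; rewrite (bigD1 i) //= mulrAC.
  by apply: ideal_mulr; [exact: primary_ideal|case: (uP i)].
move=> /(height_ge_quoP _ _ hI) hx i [_ nQ3].
have Pp := radical_prime (Qp i).
have [|u [Pu /(IQ i)]] := hx _ Pp; first by move=> /(primary_height 3 (Qp i)).
by rewrite mulrC; case: (Qp i) => _ _ pr /pr [].
Qed.

Lemma radical_topP I T : is_ideal I -> height_ge I 2 -> is_top I T ->
  forall x, radical T x <->
    forall P, is_prime P -> ~ has_chain P 3 -> I `<=` P -> P x.
Proof.
move=> hI I2 Ttop x; split=> [[l Tx] P Pp nP IP|xP].
  have /(height_ge_quoP _ _ hI) := (is_topP hI I2 Ttop _).1 Tx.
  by move=> /(_ P Pp nP)[u [Pu /IP/(primeM Pp)[//|]]]; exact: primeX.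
case: Ttop => k [Q [[Qp IE _ _] ->]].
have /choice[l lP] : forall i, exists l, codim_eq (Q i) 2 -> Q i (x ^+ l).
  move=> i; have [Q2|nQ2] := pselect (codim_eq (Q i) 2); last by exists 0%N.
  have [||l Ql] := xP (radical (Q i)) (radical_prime (Qp i)); last by exists l.
    by move=> /(primary_height 3 (Qp i)); case: Q2.
  by rewrite IE => y Qy; apply: radical_sub; exact: Qy.
exists (\sum_i l i)%N => i Qi; rewrite (bigD1 i) //= exprD.
by apply: ideal_mulr; [exact: primary_ideal|exact: lP].
Qed.

Lemma is_top_ideal I T : is_top I T -> is_ideal T.
Proof.
case=> k [Q [[Qp _ _ _] ->]]; have hQ i := primary_ideal (Qp i).
split=> [i _|x y Tx Ty i Qi|a x Tx i Qi]; first exact: ideal_zero.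
  by apply: ideal_add => //; [exact: Tx|exact: Ty].
by apply: ideal_mull => //; exact: Tx.
Qed.

Lemma is_top_sub I T : is_top I T -> I `<=` T.
Proof. by case=> k [Q [[_ -> _ _] ->]] x Ix i _; exact: Ix. Qed.

Lemma not_height_ge I h : ~ height_ge I h ->
  exists P, [/\ is_prime P, I `<=` P & ~ has_chain P h].
Proof.
move=> nI; apply: contrapT => noP; apply: nI => P Pp IP.
by apply: contrapT => nP; apply: noP; exists P.
Qed.

(** An associated prime (T : x) contains I, hence has height at least two, and lies in some prime of
    height at most two. *)
Lemma unmixed_above I T : is_ideal T -> height_ge I 2 -> I `<=` T ->
  (forall x, ~ T x -> exists P, [/\ is_prime P, ~ has_chain P 3
     & forall a, T (a * x) -> P a]) ->
  unmixed T 2.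
Proof.
move=> hT I2 IT Tx P [Pp [x PE]].
have TP : T `<=` P by move=> a Ta; rewrite PE /=; exact: ideal_mulr.
split; first by apply: height_geS I2; exact: subset_trans IT TP.
move=> /(prime_height 3 Pp) P3.
have nTx : ~ T x by move=> Tx1; apply: (prime_neq1 Pp); rewrite PE /= mul1r.
have [P' [P'p nP' xP']] := Tx x nTx; apply: nP'; apply: (has_chain_sub P3) => //.
by move=> a; rewrite PE; exact: xP'.
Qed.

Lemma top_unmixed I T : is_ideal I -> height_ge I 2 -> is_top I T -> unmixed T 2.
Proof.
move=> hI I2 Ttop; have hT := is_top_ideal Ttop.
apply: (unmixed_above hT I2 (is_top_sub Ttop)) => x nTx.
have [|P [Pp xP nP]] := @not_height_ge (quo I x) 3.
  by move=> /(is_topP hI I2 Ttop).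
exists P; split=> // a /(is_topP hI I2 Ttop)/(height_ge_quoP _ _ hI) h.
have [u [Pu]] := h P Pp nP; rewrite mulrA => /xP /(primeM Pp)[] //.
Qed.

Lemma radical_top_unmixed I T : is_ideal I -> height_ge I 2 -> is_top I T ->
  unmixed (radical T) 2.
Proof.
move=> hI I2 Ttop; have hT := is_top_ideal Ttop.
apply: (@unmixed_above I) => [|//||x nTx]; first exact: radical_ideal.
  exact: subset_trans (is_top_sub Ttop) (@radical_sub _ _).
have [P [Pp nP IP Px]] :
    exists P, [/\ is_prime P, ~ has_chain P 3, I `<=` P & ~ P x].
  apply: contrapT => noP; apply: nTx; apply/(radical_topP hI I2 Ttop) => P Pp nP IP.
  by apply: contrapT => Px; apply: noP; exists P.
exists P; split=> // a /(radical_topP hI I2 Ttop)/(_ P Pp nP IP).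
by move=> /(primeM Pp)[].
Qed.

End Top.

(** * Scaling of the variables, homogeneity and saturation of top dimensional parts *)

Section Torus.
Variables (K : fieldType) (m : nat).
Hypothesis K0 : [pchar K] =i pred0.

Definition torus (la : K) : {mpoly K[m]} -> {mpoly K[m]} :=
  mmap (@mpolyC m K) (fun i => la *: 'X_i).

HB.instance Definition _ la := GRing.RMorphism.on (torus la).

Lemma torusC la c : torus la c%:MP = c%:MP.
Proof. by rewrite /torus mmapC. Qed.

Lemma torusX la i : torus la 'X_i = la *: 'X_i.
Proof. by rewrite /torus mmapX mmap1U. Qed.

Lemma torusK la : la != 0 -> cancel (torus la) (torus la^-1).
Proof.
move=> la0; apply: (@mpoly_morph_ext _ _ _ (torus la^-1 \o torus la) idfun) => [c|i] /=.
  by rewrite !torusC.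
rewrite torusX -mul_mpolyC rmorphM /= torusC torusX mul_mpolyC scalerA mulfV //.
exact: scale1r.
Qed.

Lemma torus_homog la p d : p \is d.-homog -> torus la p = la ^+ d *: p.
Proof.
move=> /dhomogP pd; rewrite {1}/torus /mmap [in RHS](mpolyE p) scaler_sumr !big_seq.
apply: eq_bigr => mm /pd /= <-; rewrite mul_mpolyC scalerA mulrC -scalerA.
congr (_ *: _); rewrite /mmap1 mdegE -prodrXr.
rewrite (eq_bigr (fun i => (la ^+ mm i)%:MP * ('X_i : {mpoly K[m]}) ^+ mm i)).
  by rewrite big_split /= -rmorph_prod mul_mpolyC -mpolyXE_id.
by move=> i _; rewrite -mul_mpolyC exprMn rmorphXn.
Qed.

Lemma torus_sum la p : torus la p = \sum_(d < msize p) la ^+ d *: pihomog mdeg d p.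
Proof.
rewrite {1}(pihomog_sumE p) rmorph_sum; apply: eq_bigr => d _.
by apply: torus_homog; exact: pihomogP.
Qed.

(** Scaling x by 1, .., N, distinct and nonzero in characteristic zero, gives N combinations of its
    homogeneous components, which an invertible Vandermonde matrix separates. *)
Lemma torus_homogeneous (J : set {mpoly K[m]}) : is_ideal J ->
  (forall la x, la != 0 -> J x -> J (torus la x)) -> homogeneous_ideal J.
Proof.
move=> hJ Jtorus; split=> // x d Jx; pose N := msize x.
have [dN|Nd] := ltnP d N; last first.
  suff -> : pihomog mdeg d x = 0 by exact: ideal_zero.
  apply/mpolyP => mm; rewrite mcoeff_pihomog mcoeff0; case: eqP => // mmd.
  by apply: memN_msupp_eq0; apply: msize_mdeg_ge; rewrite mmd.
pose a : 'rV[K]_N := \row_j j.+1%:R; pose V := Vandermonde N a.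
have Vu : V \in unitmx.
  rewrite unitmxE unitfE det_Vandermonde; apply/prodf_neq0 => i _.
  apply/prodf_neq0 => j lij; rewrite !mxE -natrB ?ltnS ?(ltnW lij) //.
  by rewrite (GRing.pcharf0P K).1 // subSS subn_eq0 -ltnNge.
pose y : 'rV[{mpoly K[m]}]_N := \row_(e < N) pihomog mdeg e x.
have JyV j : J ((y *m map_mx (@mpolyC m K) V) 0 j).
  have := Jtorus j.+1%:R x; rewrite (GRing.pcharf0P K).1 // => /(_ erefl Jx).
  rewrite torus_sum mxE; congr J; apply: eq_bigr => e _.
  by rewrite !mxE -mul_mpolyC mulrC.
have -> : pihomog mdeg d x = (y *m map_mx (@mpolyC m K) V
    *m map_mx (@mpolyC m K) (invmx V)) 0 (Ordinal dN).
  by rewrite -mulmxA -map_mxM mulmxV // map_mx1 mulmx1 mxE.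
by rewrite mxE; apply: ideal_sum => // j _; exact: ideal_mulr.
Qed.

Lemma homogeneous_torus (J : set {mpoly K[m]}) la x :
  homogeneous_ideal J -> J x -> J (torus la x).
Proof.
move=> [hJ homJ] Jx; rewrite torus_sum; apply: ideal_sum => // d _.
by rewrite -mul_mpolyC; apply: ideal_mull => //; exact: homJ.
Qed.

Lemma torus_height (I : set {mpoly K[m]}) la x h : la != 0 -> homogeneous_ideal I ->
  height_ge (quo I x) h -> height_ge (quo I (torus la x)) h.
Proof.
move=> la0 homI hx P Pp xP.
have P' : has_chain (torus la @^-1` P) h.
  apply: hx; first exact: preim_prime.
  move=> a Iax; apply: xP; rewrite /quo /= -rmorphM; exact: homogeneous_torus.
have K1 : cancel (torus la^-1) (torus la).
  by have := @torusK la^-1; rewrite invrK; apply; rewrite invr_eq0.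
have -> : P = torus la^-1 @^-1` (torus la @^-1` P).
  by apply/funext => z /=; rewrite K1.
exact: (@preim_chain _ _ (torus la^-1) (torus la) _ _ (torusK la0)).
Qed.

(** The components of a primary decomposition need not be homogeneous, but the description of T by
    heights is invariant under scaling. T is saturated because a prime of height at most two misses
    some variable. *)
Lemma top_scheme (I T : set {mpoly K[m]}) : (3 <= m)%N -> homogeneous_ideal I ->
  height_ge I 2 -> is_top I T -> codim2_scheme_ideal T.
Proof.
move=> m3 homI I2 Ttop; have [hI _] := homI; have TE := is_topP hI I2 Ttop.
split; last exact: top_unmixed Ttop.
  apply: torus_homogeneous => [|la x la0 /TE hx]; first exact: is_top_ideal Ttop.
  by apply/TE; exact: torus_height.
move=> F [k TF]; apply/TE/(height_ge_quoP _ _ hI) => P Pp nP.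
have [i PXi] : exists i, ~ P 'X_i.
  apply: contrapT => PX; apply: nP; apply: origin_chain => // i.
  by apply: contrapT => PXi; apply: PX; exists i.
have /TE/(height_ge_quoP _ _ hI)/(_ P Pp nP)[u [Pu Iu]] : T ('X_[U_(i) *+ k] * F).
  by apply: TF; rewrite mdegMn mdeg1 mul1n.
exists (u * 'X_[U_(i) *+ k]); rewrite -mulrA; split=> //.
by apply: primeMN => //; rewrite -mpolyXn; exact: primeXN.
Qed.

Lemma radical_top_scheme (I T : set {mpoly K[m]}) : (3 <= m)%N ->
  homogeneous_ideal I -> height_ge I 2 -> is_top I T ->
  codim2_scheme_ideal (radical T).
Proof.
move=> m3 homI I2 Ttop; have [hI _] := homI; have TE := radical_topP hI I2 Ttop.
have [homT _ _] := top_scheme m3 homI I2 Ttop.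
split; last exact: radical_top_unmixed Ttop.
  apply: torus_homogeneous => [|la x la0 [k Tx]].
    by apply: radical_ideal; exact: is_top_ideal Ttop.
  by exists k; rewrite -rmorphXn; exact: homogeneous_torus.
move=> F [k TF]; apply/TE => P Pp nP IP.
have [i PXi] : exists i, ~ P 'X_i.
  apply: contrapT => PX; apply: nP; apply: origin_chain => // i.
  by apply: contrapT => PXi; apply: PX; exists i.
have /TE/(_ P Pp nP IP)/(primeM Pp)[|//] : radical T ('X_[U_(i) *+ k] * F).
  by apply: TF; rewrite mdegMn mdeg1 mul1n.
by rewrite -mpolyXn => /(primeX Pp).
Qed.

End Torus.

(** * The top dimensional part of the Jacobian ideal of a product *)

Lemma scaled_sumE (R : comNzRingType) (f g : R) (I J : set R) :
  is_ideal I -> is_ideal J -> I f -> J g ->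
  (forall y, I (g * y) -> I y) -> (forall y, J (f * y) -> J y) ->
  I `&` J `&` ideal_gen [:: f; g] = scaled_sum g I f J.
Proof.
move=> hI hJ If Jg Ireg Jreg.
apply/seteqP; split=> [x [[Ix Jx] /ideal_gen2P[u [v xE]]]|].
  exists v, u; split; last by rewrite xE; ring.
    apply: Ireg; have -> : g * v = x - u * f by rewrite xE; ring.
    by apply: ideal_sub => //; exact: ideal_mull.
  apply: Jreg; have -> : f * u = x - v * g by rewrite xE; ring.
  by apply: ideal_sub => //; exact: ideal_mull.
move=> _ [v [u [Iv Ju ->]]]; split; last first.
  by apply/ideal_gen2P; exists u, v; ring.
by split; apply: ideal_add => //; [exact: ideal_mull|exact: ideal_mulr
  |exact: ideal_mulr|exact: ideal_mull].
Qed.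

Section JacobianOfProduct.
Variables (K : fieldType) (m : nat).
Implicit Types (f g : {mpoly K[m]}).

Lemma minorC f g k l : minor g f k l = minor f g l k.
Proof. by rewrite /minor mulrC [g^`M(l) * _]mulrC. Qed.

Lemma jacobian_mul_sub f g : jacobian_ideal f f ->
  jacobian_ideal (f * g) `<=` jacobian_ideal f.
Proof.
move=> fJ; apply: jacobian_ideal_sub => [|i]; first exact: jacobian_ideal_ideal.
have hJ := jacobian_ideal_ideal f.
rewrite mderivM; apply: ideal_add => //; apply: ideal_mulr => //.
exact: jacobian_ideal_mem.
Qed.

Lemma jacobian_mul_sqr f g x : jacobian_ideal (f * g) (f * g) ->
  jacobian_ideal f x -> jacobian_ideal (f * g) (g ^+ 2 * x).
Proof.
move=> fgJ; have hJ := jacobian_ideal_ideal (f * g).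
suff : jacobian_ideal f `<=` [set x | jacobian_ideal (f * g) (g ^+ 2 * x)] by apply.
apply: jacobian_ideal_sub => [|i] /=.
  split=> [|a b|c a] /=; first by rewrite mulr0; exact: ideal_zero.
    by rewrite mulrDr; exact: ideal_add.
  by rewrite mulrCA; exact: ideal_mull.
have -> : g ^+ 2 * f^`M(i) = g * (f * g)^`M(i) - g^`M(i) * (f * g).
  by rewrite mderivM; ring.
by apply: ideal_sub => //; apply: ideal_mull => //; exact: jacobian_ideal_mem.
Qed.

Lemma jacobian_mul_minor f g k l : jacobian_ideal (f * g) (f * minor f g k l).
Proof.
have hJ := jacobian_ideal_ideal (f * g).
have -> : f * minor f g k l = f^`M(k) * (f * g)^`M(l) - f^`M(l) * (f * g)^`M(k).
  by rewrite /minor !mderivM; ring.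
by apply: ideal_sub => //; apply: ideal_mull => //; exact: jacobian_ideal_mem.
Qed.

Lemma jacobian_mul_sqr_l f g x : jacobian_ideal (f * g) (f * g) ->
  jacobian_ideal g x -> jacobian_ideal (f * g) (f ^+ 2 * x).
Proof. by rewrite mulrC; exact: jacobian_mul_sqr. Qed.

Lemma jacobian_mul_minor_l f g k l : jacobian_ideal (f * g) (g * minor f g k l).
Proof. by rewrite minorC (mulrC f g); exact: jacobian_mul_minor. Qed.

Lemma jacobian_minor f g k l : jacobian_ideal f (minor f g k l).
Proof.
have hJ := jacobian_ideal_ideal f.
by apply: ideal_sub => //; apply: ideal_mulr => //; exact: jacobian_ideal_mem.
Qed.

End JacobianOfProduct.

Section TopOfProduct.
Variables (K : fieldType) (m : nat).
Implicit Types (f g x y : {mpoly K[m]}) (P T : set {mpoly K[m]}).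

(* V(f) and V(g) meet transversally in codimension two. *)
Definition transversal f g := forall P, is_prime P -> ~ has_chain P 3 ->
  P f -> P g -> exists k l, ~ P (minor f g k l).

Lemma transversalC f g : transversal f g -> transversal g f.
Proof.
move=> tr P Pp nP Pg Pf; have [k [l Pkl]] := tr P Pp nP Pf Pg.
by exists l, k; rewrite minorC.
Qed.

(** The minors of (f, g) lie in Jac(f), so they would all lie in P. *)
Lemma transversal_notin f g P : transversal f g -> is_prime P -> ~ has_chain P 3 ->
  jacobian_ideal f f -> jacobian_ideal f `<=` P -> ~ P g.
Proof.
move=> tr Pp nP fJ JP Pg; have [k [l]] := tr P Pp nP (JP _ fJ) Pg.
by apply; apply: JP; exact: jacobian_minor.
Qed.

Lemma top_regular f g T y : jacobian_ideal f f -> transversal f g ->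
  height_ge (jacobian_ideal f) 2 -> is_top (jacobian_ideal f) T ->
  T (g * y) -> T y.
Proof.
move=> fJ tr J2 Ttop; have hJ := jacobian_ideal_ideal f.
have TE := is_topP hJ J2 Ttop => /TE/(height_ge_quoP _ _ hJ) Tgy.
apply/TE/(height_ge_quoP _ _ hJ) => P Pp nP.
have [u [Pu Ju]] := Tgy P Pp nP.
have [JP|] := pselect (jacobian_ideal f `<=` P).
  exists (u * g); rewrite -mulrA; split=> //.
  by apply: primeMN => //; exact: transversal_notin JP.
move=> /existsNP[z] /not_implyP[Jz Pz].
by exists z; split=> //; exact: ideal_mulr.
Qed.

Lemma radical_top_regular f g T y : jacobian_ideal f f -> transversal f g ->
  height_ge (jacobian_ideal f) 2 -> is_top (jacobian_ideal f) T ->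
  radical T (g * y) -> radical T y.
Proof.
move=> fJ tr J2 Ttop; have TE := radical_topP (jacobian_ideal_ideal f) J2 Ttop.
move=> /TE Tgy; apply/TE => P Pp nP JP.
by case: (primeM Pp (Tgy P Pp nP JP)) => // /(transversal_notin tr Pp nP fJ JP).
Qed.

Lemma quoS (I J : set {mpoly K[m]}) x : I `<=` J -> quo I x `<=` quo J x.
Proof. by move=> IJ a; exact: IJ. Qed.

Section Product.
Variables (f g : {mpoly K[m]}) (Tfg Tf Tg : set {mpoly K[m]}).
Hypotheses (fJ : jacobian_ideal f f) (gJ : jacobian_ideal g g).
Hypothesis fgJ : jacobian_ideal (f * g) (f * g).
Hypothesis tr : transversal f g.
Hypotheses (f2 : height_ge (jacobian_ideal f) 2) (g2 : height_ge (jacobian_ideal g) 2).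
Hypothesis fg2 : height_ge (jacobian_ideal (f * g)) 2.
Hypothesis ftop : is_top (jacobian_ideal f) Tf.
Hypothesis gtop : is_top (jacobian_ideal g) Tg.
Hypothesis fgtop : is_top (jacobian_ideal (f * g)) Tfg.
Hypothesis fg_unmixed : forall x, height_ge (quo (ideal_gen [:: f; g]) x) 3 ->
  ideal_gen [:: f; g] x.
Hypothesis fg_radical : forall P x, is_prime P -> ~ has_chain P 3 -> P f -> P g ->
  P x -> exists u, ~ P u /\ ideal_gen [:: f; g] (u * x).

Let hf := jacobian_ideal_ideal f.
Let hg := jacobian_ideal_ideal g.
Let hfg := jacobian_ideal_ideal (f * g).
Let TfE := is_topP hf f2 ftop.
Let TgE := is_topP hg g2 gtop.
Let TfgE := is_topP hfg fg2 fgtop.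
Let rTfE := radical_topP hf f2 ftop.
Let rTgE := radical_topP hg g2 gtop.
Let rTfgE := radical_topP hfg fg2 fgtop.

Let JfgJf : jacobian_ideal (f * g) `<=` jacobian_ideal f.
Proof. exact: jacobian_mul_sub. Qed.

Let JfgJg : jacobian_ideal (f * g) `<=` jacobian_ideal g.
Proof. by rewrite mulrC; exact: jacobian_mul_sub. Qed.

Let gen_ideal : is_ideal (ideal_gen [:: f; g]).
Proof. exact: ideal_gen_ideal. Qed.

Let genf : ideal_gen [:: f; g] f.
Proof. by apply: ideal_gen_mem; rewrite inE eqxx. Qed.

Let geng : ideal_gen [:: f; g] g.
Proof. by apply: ideal_gen_mem; rewrite !inE eqxx orbT. Qed.

Let Jfg_gen : jacobian_ideal (f * g) `<=` ideal_gen [:: f; g].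
Proof.
apply: jacobian_ideal_sub => // i; rewrite mderivM.
by apply: ideal_add => //; [exact: ideal_mull|exact: ideal_mulr].
Qed.

Lemma top_product : Tfg = Tf `&` Tg `&` ideal_gen [:: f; g].
Proof.
apply/seteqP; split=> x.
  move=> /TfgE hx; split; first split.
  - by apply/TfE; apply: height_geS hx; exact: quoS.
  - by apply/TgE; apply: height_geS hx; exact: quoS.
  - by apply: fg_unmixed; apply: height_geS hx; exact: quoS.
move=> [[/TfE/(height_ge_quoP _ _ hf) fx /TgE/(height_ge_quoP _ _ hg) gx]].
move=> /ideal_gen2P[u [v xE]].
apply/TfgE/(height_ge_quoP _ _ hfg) => P Pp nP.
have [Pg|Pg] := pselect (P g); last first.
  have [w [Pw Jw]] := fx P Pp nP; exists (g ^+ 2 * w).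
  split; first by apply: primeMN => //; exact: primeXN.
  by rewrite -mulrA; exact: jacobian_mul_sqr.
have [Pf|Pf] := pselect (P f); last first.
  have [w [Pw Jw]] := gx P Pp nP; exists (f ^+ 2 * w).
  split; first by apply: primeMN => //; exact: primeXN.
  by rewrite -mulrA; exact: jacobian_mul_sqr_l.
have [k [l Pkl]] := tr Pp nP Pf Pg; exists (minor f g k l); split=> //.
rewrite xE mulrDr; apply: ideal_add => //.
  have -> : minor f g k l * (u * f) = u * (f * minor f g k l) by ring.
  by apply: ideal_mull => //; exact: jacobian_mul_minor.
have -> : minor f g k l * (v * g) = v * (g * minor f g k l) by ring.
by apply: ideal_mull => //; exact: jacobian_mul_minor_l.
Qed.

(** The radical stays inside (f, g), since (f, g) is unmixed and generates the maximal ideal of R_P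
    at each P of height at most two containing it. *)
Lemma radical_top_product :
  radical Tfg = radical Tf `&` radical Tg `&` ideal_gen [:: f; g].
Proof.
apply/seteqP; split=> x.
  move=> /rTfgE hx; split; first split.
  - by apply/rTfE => P Pp nP JP; apply: hx => //; exact: subset_trans JP.
  - by apply/rTgE => P Pp nP JP; apply: hx => //; exact: subset_trans JP.
  - apply: fg_unmixed; apply/(height_ge_quoP _ _ gen_ideal) => P Pp nP.
    have [Pf|Pf] := pselect (P f); last by exists f; split=> //; exact: ideal_mulr.
    have [Pg|Pg] := pselect (P g); last by exists g; split=> //; exact: ideal_mulr.
    apply: fg_radical => //; apply: hx => //; apply: subset_trans Jfg_gen _.
    apply: ideal_gen_sub; first exact: prime_ideal.
    by move=> z; rewrite !inE => /orP[] /eqP ->.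
move=> [[/rTfE fx /rTgE gx]] /ideal_gen2P[u [v xE]].
apply/rTfgE => P Pp nP JP; have hP := prime_ideal Pp.
have [Pg|Pg] := pselect (P g); last first.
  apply: fx => // z Jz; have /JP /(primeM Pp)[|//] := jacobian_mul_sqr fgJ Jz.
  by move=> /(primeX Pp).
have [Pf|Pf] := pselect (P f); last first.
  apply: gx => // z Jz; have /JP /(primeM Pp)[|//] := jacobian_mul_sqr_l fgJ Jz.
  by move=> /(primeX Pp).
by rewrite xE; apply: ideal_add => //; exact: ideal_mull.
Qed.

Lemma top_scaled_sum : Tfg = scaled_sum g Tf f Tg.
Proof.
rewrite top_product; apply: scaled_sumE.
- exact: is_top_ideal ftop.
- exact: is_top_ideal gtop.
- exact: (is_top_sub ftop).
- exact: (is_top_sub gtop).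
- by move=> y; apply: (top_regular fJ tr f2 ftop).
- by move=> y; apply: (top_regular gJ (transversalC tr) g2 gtop).
Qed.

Lemma radical_top_scaled_sum :
  radical Tfg = scaled_sum g (radical Tf) f (radical Tg).
Proof.
rewrite radical_top_product; apply: scaled_sumE.
- by apply: radical_ideal; exact: is_top_ideal ftop.
- by apply: radical_ideal; exact: is_top_ideal gtop.
- by apply: radical_sub; exact: (is_top_sub ftop).
- by apply: radical_sub; exact: (is_top_sub gtop).
- by move=> y; apply: (radical_top_regular fJ tr f2 ftop).
- by move=> y; apply: (radical_top_regular gJ (transversalC tr) g2 gtop).
Qed.

End Product.
End TopOfProduct.

(** * Arrangements *)

Lemma hypersurface_form_prod (K : fieldType) m (T : finType)
    (h : T -> {mpoly K[m]}) (k : T) :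
  (forall i, hypersurface_form (h i)) -> hypersurface_form (\prod_i h i).
Proof.
move=> hh; split; first by apply/prodf_neq0 => i _; case: (hh i).
rewrite (bigD1 k) //=.
have [e pe] : exists e, \prod_(i | i != k) h i \is e.-homog.
  apply: (big_ind (fun p : {mpoly K[m]} => exists e, p \is e.-homog)).
  - by exists 0%N; exact: dhomog1.
  - by move=> p q [d pd] [e qe]; exists (d + e)%N; exact: dhomogM.
  - by move=> i _; case: (hh i) => _ [d [_ hd]]; exists d.
case: (hh k) => _ [d [d0 hd]]; exists (d + e)%N.
by split; [rewrite addn_gt0 d0|exact: dhomogM].
Qed.

Lemma jacobian_form (K : fieldType) m (F : {mpoly K[m]}) : [pchar K] =i pred0 ->
  hypersurface_form F -> jacobian_ideal F F /\ homogeneous_ideal (jacobian_ideal F).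
Proof.
move=> K0 [_ [d [d0 Fd]]]; split; first exact: jacobian_ideal_self Fd.
exact: jacobian_ideal_homogeneous Fd.
Qed.

Lemma form_mcoeff0 (K : fieldType) m (F : {mpoly K[m]}) :
  hypersurface_form F -> F@_0 = 0.
Proof.
move=> [_ [d [d0 Fd]]]; apply: (dhomog_nemf_coeff Fd).
by rewrite /= mdeg0 eq_sym -lt0n.
Qed.

Section Arrangement.
Variables (K : closedFieldType) (m : nat).
Hypotheses (K0 : [pchar K] =i pred0) (m_gt0 : (0 < m)%N).
Local Notation R := {mpoly K[m.+2]}.

(** A prime containing the Jacobian ideal contains some h_k. If it contains a second one, [h2]
    applies; if not, the cofactor of h_k is invertible at P, so Jac(h_k) lies in P and
    [jacobian_height] applies. *)
Lemma arrangement_jacobian_height (T : finType) (h : T -> R) (k0 : T) :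
  (forall k, hypersurface_form (h k)) ->
  (forall k l, k != l -> height_ge (ideal_gen [:: h k; h l]) 2) ->
  (forall k, exists2 b, hypersurface_form b & smooth_intersection [:: h k; b]) ->
  height_ge (jacobian_ideal (\prod_k h k)) 2.
Proof.
move=> hh h2 hb P Pp JP; have hP := prime_ideal Pp.
have [hJ _] := jacobian_form K0 (hypersurface_form_prod k0 hh).
have [k Pk] := prime_prod Pp (JP _ hJ).
have [[l [lk Pl]]|noP] := pselect (exists l, l != k /\ P (h l)).
  apply: (h2 l k lk) => //; apply: ideal_gen_sub => // x.
  by rewrite !inE => /orP[] /eqP ->.
have Pu : ~ P (\prod_(l | l != k) h l).
  by apply: prime_prodN => // l lk Pl; apply: noP; exists l.
have [[hk0 [d [d0 hd]]] [b [b0 [e [e0 be]]] sm]] := (hh k, hb k).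
apply: (jacobian_height K0 m_gt0 hk0 hd be d0 e0 sm) => //.
apply: jacobian_ideal_sub => // i.
have : P ((\prod_k h k)^`M(i)) by apply: JP; exact: jacobian_ideal_mem.
rewrite (bigD1 k) //= mderivM => Pd.
have : P ((h k)^`M(i) * \prod_(l | l != k) h l).
  rewrite -[X in P X](addrK (h k * (\prod_(l | l != k) h l)^`M(i))).
  by apply: ideal_sub => //; exact: ideal_mulr.
by case/(primeM Pp).
Qed.

Section Products.
Variables (s t : nat) (fs : 'I_s -> R) (gs : 'I_t -> R).
Hypotheses (fs_form : forall i, hypersurface_form (fs i))
  (gs_form : forall j, hypersurface_form (gs j)).
Hypothesis smooth_fg : forall i j, smooth_intersection [:: fs i; gs j].
Let f := \prod_i fs i.
Let g := \prod_j gs j.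
Hypothesis ffg : forall i j : 'I_s, i != j ->
  height_ge (ideal_gen [:: fs i; fs j; g]) 3.
Hypothesis fgg : forall i j : 'I_t, i != j ->
  height_ge (ideal_gen [:: f; gs i; gs j]) 3.

(** A second f_k or g_k in P would give P height at least three, by [ffg] or [fgg]. *)
Lemma unique_components (P : set R) : is_prime P -> ~ has_chain P 3 -> P f -> P g ->
  exists i j u w, [/\ P (fs i), P (gs j), f = fs i * u, g = gs j * w & ~ P u /\ ~ P w].
Proof.
move=> Pp nP Pf Pg; have [i Pi] := prime_prod Pp Pf; have [j Pj] := prime_prod Pp Pg.
exists i, j, (\prod_(k | k != i) fs k), (\prod_(k | k != j) gs k).
split=> //; [exact: bigD1|exact: bigD1|split].
  apply: prime_prodN => // k ki Pk; apply: nP; apply: (ffg ki) => //.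
  apply: ideal_gen_sub; first exact: prime_ideal.
  by move=> x; rewrite !inE => /or3P[] /eqP ->.
apply: prime_prodN => // k kj Pk; apply: nP; apply: (fgg kj) => //.
apply: ideal_gen_sub; first exact: prime_ideal.
by move=> x; rewrite !inE => /or3P[] /eqP ->.
Qed.

Lemma products_height : height_ge (ideal_gen [:: f; g]) 2.
Proof.
move=> P Pp fgP; have [|i Pi] := @prime_prod _ P _ fs Pp.
  by apply: fgP; apply: ideal_gen_mem; rewrite inE eqxx.
have [|j Pj] := @prime_prod _ P _ gs Pp.
  by apply: fgP; apply: ideal_gen_mem; rewrite !inE eqxx orbT.
apply: (smooth_height (smooth_fg i j)) => //.
apply: ideal_gen_sub; first exact: prime_ideal.
by move=> x; rewrite !inE => /orP[] /eqP ->.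
Qed.

Lemma products_transversal : transversal f g.
Proof.
move=> P Pp nP Pf Pg; have hP := prime_ideal Pp.
have [i [j [u [w [Pi Pj fE gE [Pu Pw]]]]]] := unique_components Pp nP Pf Pg.
have [_ [d [_ fd]]] := fs_form i; have [_ [e [_ ge]]] := gs_form j.
have [k [l Pkl]] := smooth_minor (m_gt0 : (3 <= m.+2)%N) fd ge (smooth_fg i j) Pp nP Pi Pj.
exists k, l => Pm; suff : P (u * w * minor (fs i) (gs j) k l).
  by case/(primeM Pp) => // /(primeM Pp)[].
(* [q] lies in P along with f_i and g_j: modulo P, the minors of (f, g) are u w times those of (f_i,
   g_j). *)
pose q := fs i * (u^`M(k) * (g^`M(l)) - u^`M(l) * g^`M(k))
  + gs j * u * ((fs i)^`M(k) * w^`M(l) - (fs i)^`M(l) * w^`M(k)).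
have -> : u * w * minor (fs i) (gs j) k l = minor f g k l - q.
  by rewrite /q /minor fE gE !mderivM; ring.
by apply: ideal_sub => //; apply: ideal_add => //; rewrite -?mulrA; exact: ideal_mulr.
Qed.

Lemma products_local (P : set R) x : is_prime P -> ~ has_chain P 3 -> P f -> P g ->
  P x -> exists u, ~ P u /\ ideal_gen [:: f; g] (u * x).
Proof.
move=> Pp nP Pf Pg Px.
have [i [j [u [w [Pi Pj fE gE [Pu Pw]]]]]] := unique_components Pp nP Pf Pg.
have [fi0 [d [_ fd]]] := fs_form i; have [_ [e [_ ge]]] := gs_form j.
have [v [Pv]] := smooth_local m_gt0 fi0 fd ge (smooth_fg i j) Pp nP Pi Pj Px.
move=> /ideal_gen2P[p [q vx]]; exists (u * w * v).
split; first by apply: primeMN => //; exact: primeMN.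
apply/ideal_gen2P; exists (w * p), (u * q).
by rewrite -mulrA vx fE gE; ring.
Qed.

Lemma products_neq0 : f != 0.
Proof. by apply/prodf_neq0 => i _; case: (fs_form i). Qed.

Lemma products_unmixed x : height_ge (quo (ideal_gen [:: f; g]) x) 3 ->
  ideal_gen [:: f; g] x.
Proof. by apply: two_unmixed; [exact: products_neq0|exact: products_height]. Qed.

(** At a prime of height at most two containing f and g, (f, g) coincides with a single (f_i, g_j);
    unmixedness of (f, g) globalizes this. *)
Lemma bigcap_pairs : \bigcap_(ij in [set: 'I_s * 'I_t]) ideal_gen [:: fs ij.1; gs ij.2]
  = ideal_gen [:: f; g].
Proof.
have hI := @ideal_gen_ideal R [:: f; g].
apply/seteqP; split=> x.
  move=> xB; apply: products_unmixed; apply/(height_ge_quoP _ _ hI) => P Pp nP.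
  have [Pf|Pf] := pselect (P f); last first.
    exists f; split=> //; apply: ideal_mulr => //; apply: ideal_gen_mem.
    by rewrite inE eqxx.
  have [Pg|Pg] := pselect (P g); last first.
    exists g; split=> //; apply: ideal_mulr => //; apply: ideal_gen_mem.
    by rewrite !inE eqxx orbT.
  have [i [j [u [w [Pi Pj fE gE [Pu Pw]]]]]] := unique_components Pp nP Pf Pg.
  exists (u * w); split; first exact: primeMN.
  have /ideal_gen2P[p [q ->]] := xB (i, j) I.
  by apply/ideal_gen2P; exists (w * p), (u * q); rewrite fE gE /=; ring.
move=> /ideal_gen2P[p [q ->]] [i j] _ /=; apply/ideal_gen2P.
exists (p * \prod_(k | k != i) fs k), (q * \prod_(k | k != j) gs k).
rewrite {1}/f {1}/g (bigD1 i) //= [\prod_j gs j](bigD1 j) //=; ring.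
Qed.

Lemma products_regular : f@_0 = 0 -> g@_0 = 0 -> regular_sequence [:: f; g].
Proof.
move=> f0 g0; split=> [[|[|//]] x _ /=|].
- move=> [c]; rewrite big_ord0 => /eqP; rewrite mulf_eq0 (negPf products_neq0) /=.
  by move=> /eqP ->; exists (fun=> 0); rewrite big_ord0.
- have := @principal_unmixed K m.+1 f x products_neq0.
  move=> unm /ideal_gen1P[u gx]; apply: unm.
  apply: height_geS products_height => z /ideal_gen2P[v [w ->]].
  apply/ideal_gen1P; exists (v * x + w * u).
  by rewrite mulrDl -[w * g * x]mulrA gx; ring.
- move=> /ideal_gen2P[p [q /(congr1 (mcoeff 0%MM))]].
  rewrite mcoeff1 eqxx mcoeffD !rmorphM /= f0 g0 !mulr0 addr0 => /eqP.
  by rewrite oner_eq0.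
Qed.

End Products.
End Arrangement.

Theorem theorem4p5 (K : closedFieldType) (charK0 : [pchar K] =i pred0)
  (n : nat) (n_ge2 : (2 <= n)%N)
  (s t : nat) (s_gt0 : (0 < s)%N) (t_gt0 : (0 < t)%N)
  (fs : 'I_s -> {mpoly K[n.+1]}) (gs : 'I_t -> {mpoly K[n.+1]})
  (fs_form : forall i, hypersurface_form (fs i))
  (gs_form : forall j, hypersurface_form (gs j))
  (distinct : forall k l : 'I_s + 'I_t, k != l ->
     ideal_gen [:: join_family fs gs k] <> ideal_gen [:: join_family fs gs l])
  (f g : {mpoly K[n.+1]})
  (f_def : f = \prod_(i < s) fs i) (g_def : g = \prod_(j < t) gs j)
  (smooth_pairs : forall k l : 'I_s + 'I_t, k != l ->
     smooth_intersection [:: join_family fs gs k; join_family fs gs l])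
  (codim_ffg : forall i j : 'I_s, i != j ->
     codim_eq (ideal_gen [:: fs i; fs j; g]) 3)
  (codim_fgg : forall i j : 'I_t, i != j ->
     codim_eq (ideal_gen [:: f; gs i; gs j]) 3)
  (Tfg Tf Tg : set {mpoly K[n.+1]})
  (Tfg_top : is_top (jacobian_ideal (f * g)) Tfg)
  (Tf_top : is_top (jacobian_ideal f) Tf)
  (Tg_top : is_top (jacobian_ideal g) Tg) :
  let B := \bigcap_(ij in [set: 'I_s * 'I_t]) ideal_gen [:: fs ij.1; gs ij.2] in
  [/\ B = ideal_gen [:: f; g],
      [/\ Tfg = Tf `&` Tg `&` B,
          Tfg = scaled_sum g Tf f Tg
        & liaison_addition Tf Tg f g Tfg]
    & [/\ radical Tfg = radical Tf `&` radical Tg `&` B,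
          radical Tfg = scaled_sum g (radical Tf) f (radical Tg)
        & liaison_addition (radical Tf) (radical Tg) f g (radical Tfg)]].
Proof.
(* Put n = m + 1: the ring has m + 2 variables and the bound on n becomes 0 < m. *)
move=> B; case: n n_ge2 => [|m] m_gt0 // in fs gs fs_form gs_form distinct f g
  f_def g_def smooth_pairs codim_ffg codim_fgg Tfg Tf Tg Tfg_top Tf_top Tg_top B *.
subst f g; rewrite ltnS in m_gt0.
pose i0 := Ordinal s_gt0; pose j0 := Ordinal t_gt0.
have smooth_fg i j : smooth_intersection [:: fs i; gs j].
  exact: (smooth_pairs (inl i) (inr j)).
have pair2 k l : k != l ->
    height_ge (ideal_gen [:: join_family fs gs k; join_family fs gs l]) 2.
  by move=> kl; exact: smooth_height (smooth_pairs k l kl).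
have ffg i j (ij : i != j) := (codim_ffg i j ij).1.
have fgg i j (ij : i != j) := (codim_fgg i j ij).1.
set f := \prod_i fs i in ffg fgg Tfg_top Tf_top *.
set g := \prod_j gs j in ffg fgg Tfg_top Tg_top *.
have f_form : hypersurface_form f by exact: hypersurface_form_prod i0 fs_form.
have g_form : hypersurface_form g by exact: hypersurface_form_prod j0 gs_form.
have join_form k : hypersurface_form (join_family fs gs k) by case: k.
have fgE : f * g = \prod_k join_family fs gs k by rewrite big_sumType.
have fg_form : hypersurface_form (f * g).
  by rewrite fgE; exact: hypersurface_form_prod (inl i0) join_form.
(* A partner meeting the hypersurface smoothly is taken from the other arrangement, so that one
   exists even when s = 1 or t = 1. *)
have join_smooth k : exists2 b, hypersurface_form b &
    smooth_intersection [:: join_family fs gs k; b].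
  case: k => [i|j]; first by exists (gs j0) => //; exact: smooth_fg.
  by exists (fs i0) => //; exact: (smooth_pairs (inr j) (inl i0)).
have f2 : height_ge (jacobian_ideal f) 2.
  apply: (arrangement_jacobian_height charK0 m_gt0 i0 fs_form) => [k l kl|k].
    exact: (pair2 (inl k) (inl l)).
  exact: (join_smooth (inl k)).
have g2 : height_ge (jacobian_ideal g) 2.
  apply: (arrangement_jacobian_height charK0 m_gt0 j0 gs_form) => [k l kl|k].
    exact: (pair2 (inr k) (inr l)).
  exact: (join_smooth (inr k)).
have fg2 : height_ge (jacobian_ideal (f * g)) 2.
  rewrite fgE; exact: (arrangement_jacobian_height charK0 m_gt0 (inl i0) join_form).
have [fJ fhom] := jacobian_form charK0 f_form.
have [gJ ghom] := jacobian_form charK0 g_form.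
have [fgJ _] := jacobian_form charK0 fg_form.
have tr : transversal f g by exact: products_transversal.
have unm := products_unmixed fs_form smooth_fg.
have loc := products_local m_gt0 fs_form gs_form smooth_fg ffg fgg.
have BE : B = ideal_gen [:: f; g] by exact: bigcap_pairs.
have deg_f : exists d, f \is d.-homog by case: f_form => _ [d [_ fd]]; exists d.
have deg_g : exists d, g \is d.-homog by case: g_form => _ [d [_ gd]]; exists d.
have reg : regular_sequence [:: f; g].
  by apply: products_regular => //; exact: form_mcoeff0.
have Tff := is_top_sub Tf_top fJ; have Tgg := is_top_sub Tg_top gJ.
have sumE := top_scaled_sum fJ gJ fgJ tr f2 g2 fg2 Tf_top Tg_top Tfg_top unm.
have rsumE := radical_top_scaled_sum fJ gJ fgJ tr f2 g2 fg2 Tf_top Tg_top Tfg_top unm loc.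
have m3 : (3 <= m.+2)%N by [].
split=> //; rewrite BE; split=> //.
- exact: (top_product fJ gJ fgJ tr f2 g2 fg2 Tf_top Tg_top Tfg_top unm).
- split=> //; split; first exact: (top_scheme charK0 m3 fhom f2 Tf_top).
  exact: (top_scheme charK0 m3 ghom g2 Tg_top).
- exact: (radical_top_product fJ gJ fgJ f2 g2 fg2 Tf_top Tg_top Tfg_top unm loc).
- split=> //; last by split; exact: radical_sub.
  split; first exact: (radical_top_scheme charK0 m3 fhom f2 Tf_top).
  exact: (radical_top_scheme charK0 m3 ghom g2 Tg_top).
Qed.
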